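(* Let $G \cong C_2 \oplus C_2 \oplus C_{2n}$, where $n \ge 2$ is an integer. A sequence $S$ over $G$ of length $|S| = \mathsf{s}(G) - 1 = 4n+2$ contains no zero-sum subsequence of length $\exp(G)=2n$ if and only if there exist a basis $\{f_1,f_2,f_3\}$ of $G$ with $\operatorname{ord}(f_1)=\operatorname{ord}(f_2)=2$ and $\operatorname{ord}(f_3)=2n$, and an element $f \in G$, such that the translated sequence $-f + S$ is equal to one of the following sequences: (s1) $0^{2\alpha+1} f_2^{2n-2\alpha-1} f_3^{2n-1-2\beta} (f_3+f_2)^{2\beta+1} (a f_3 + f_1)\bigl((1-a) f_3 + f_2 + f_1\bigr)$ with $a \in [2,n-1]$ and $\alpha,\beta \in [0,n-1]$; (s2) $0^{2n-1} f_3^{2n-1} (a f_3 + f_2)\bigl((1-a)f_3 + f_2\bigr)(b f_3 + f_1)\bigl((1-b) f_3 + f_1\bigr)$ with $a,b \in [2,n-1]$ and $a \ge b$; (s3) $0^{2\alpha+1} f_1^{2\beta+1} f_2^{2\gamma+1} \prod_{i=1}^{2n+1} (f_3 + d_i)$, where $\alpha,\beta,\gamma \in [0,n-1]$ satisfy $\alpha+\beta+\gamma = n-1$, and $S' = \prod_{i=1}^{2n+1} d_i$ is a sequence over the subgroup $\langle f_1,f_2\rangle$ with $\sigma(S') \notin \operatorname{supp}(S')$.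
   Context: $C_m$ denotes a cyclic group of order $m$; $\operatorname{ord}(g)$ is the order of $g$; $[a,b]=\{z\in\mathbb{Z}: a\le z\le b\}$. A basis of a finite abelian group is an independent generating set, where $g_1,\dots,g_k$ are independent if $\sum a_i g_i = 0$ with integers $a_i$ implies $a_i g_i = 0$ for all $i$. A sequence over $G$ is an element of the free abelian monoid over $G$ (finite multiset, written multiplicatively; $g^k$ means $g$ repeated $k$ times). For $S = g_1\cdots g_\ell$: $|S|=\ell$, $\sigma(S)=\sum g_i$, $\operatorname{supp}(S)$ is the set of distinct elements occurring in $S$; for $h\in G$, $h+S = (h+g_1)\cdots(h+g_\ell)$. A subsequence is a sub-multiset; a zero-sum sequence is one with sum $0$. $\exp(G)$ is the exponent of $G$. $\mathsf{s}(G)$ (Erdős–Ginzburg–Ziv constant) is the smallest integer $\ell$ such that every sequence over $G$ of length at least $\ell$ has a zero-sum subsequence of length exactly $\exp(G)$; for this $G$, $\mathsf{s}(G)=4n+3$. *)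

(* Defs.v *)
From HB Require Import structures.
From mathcomp Require Import all_boot all_order all_algebra all_fingroup all_solvable.

Set Implicit Arguments.
Unset Strict Implicit.
Unset Printing Implicit Defensive.

Import GRing.Theory.
Local Open Scope ring_scope.

(* Sequences over G, i.e. elements of the free abelian monoid over G, are
   represented by lists considered up to [perm_eq]. *)

(* Divisibility in the free abelian monoid: inclusion of multisets, not of
   lists (compare [subseq]). *)
Definition is_subsequence (G : eqType) (T S : seq G) : Prop :=
  forall x : G, (count_mem x T <= count_mem x S)%N.

Definition zero_sum (G : nmodType) (S : seq G) : Prop :=
  \sum_(x <- S) x = 0.

Definition translate (G : zmodType) (h : G) (S : seq G) : seq G :=
  [seq h + x | x <- S].

Definition independent (G : zmodType) (k : nat) (g : k.-tuple G) : Prop :=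
  forall a : 'I_k -> int,
    \sum_(i < k) tnth g i *~ a i = 0 -> forall i, tnth g i *~ a i = 0.

(* Generated subgroups, element orders and the exponent are those of the
   finite group that MathComp attaches to the addition of G. *)
Definition is_basis (G : finZmodType) (k : nat) (g : k.-tuple G) : Prop :=
  independent g /\ <<[set:: g]>>%g = [set: G].

Definition is_C2_C2_C2n (G : finZmodType) (n : nat) : Prop :=
  exists phi : {additive G -> ('Z_2 * 'Z_2 * 'Z_(2 * n))%type}, bijective phi.

(* For 1 < n the subtractions on nat below are never truncated in the given
   ranges; 1 - a is a subtraction in int. *)
Section Families.
Variables (G : finZmodType) (n : nat) (f1 f2 f3 : G).

Definition family_s1 (S : seq G) : Prop :=
  exists a alpha beta : nat,
    [/\ (2 <= a <= n - 1)%N, (alpha <= n - 1)%N, (beta <= n - 1)%N &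
      perm_eq S
        (nseq (2 * alpha + 1) 0 ++ nseq (2 * n - 2 * alpha - 1) f2
         ++ nseq (2 * n - 1 - 2 * beta) f3 ++ nseq (2 * beta + 1) (f3 + f2)
         ++ [:: f3 *~ a%:Z + f1; f3 *~ (1 - a%:Z) + f2 + f1])].

Definition family_s2 (S : seq G) : Prop :=
  exists a b : nat,
    [/\ (2 <= a <= n - 1)%N, (2 <= b <= n - 1)%N, (b <= a)%N &
      perm_eq S
        (nseq (2 * n - 1) 0 ++ nseq (2 * n - 1) f3
         ++ [:: f3 *~ a%:Z + f2; f3 *~ (1 - a%:Z) + f2;
                f3 *~ b%:Z + f1; f3 *~ (1 - b%:Z) + f1])].

Definition family_s3 (S : seq G) : Prop :=
  exists (alpha beta gamma : nat) (S' : seq G),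
    [/\ [/\ (alpha <= n - 1)%N, (beta <= n - 1)%N, (gamma <= n - 1)%N &
            (alpha + beta + gamma = n - 1)%N],
        size S' = (2 * n + 1)%N,
        {subset S' <= <<[set f1; f2]>>%g},
        \sum_(d <- S') d \notin S' &
      perm_eq S
        (nseq (2 * alpha + 1) 0 ++ nseq (2 * beta + 1) f1
         ++ nseq (2 * gamma + 1) f2 ++ [seq f3 + d | d <- S'])].

End Families.

(* Main.v *)
(* The first step is the inverse Erdos-Ginzburg-Ziv theorem for C_n: a sequence
   of length 2n-2 without zero-sum subsequence of length n is x^(n-1) y^(n-1)
   with x - y a generator. For n prime, split the sequence into pairs of
   distinct elements; the choices of one element per pair grow too fast unless
   all the pairs have the same difference up to sign. For n = km, split off
   blocks of length k with sum divisible by k and exchange elements between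
   the blocks and the rest.

   For G, work modulo 2G, a cyclic group of order n with G/2G of order 8. Two
   elements of the same class form a pair with sum in 2G, so after removing
   pairs as long as possible at most 8 elements remain, of distinct classes, an
   even number of them. If at most 4 remain, there are 2n-1 pairs, hence a
   zero-sum subsequence of length 2n. Otherwise the pair sums are x^(n-1)
   y^(n-1), possibly with one term missing, and every quadruple of remaining
   elements whose classes add up to 0 has sum x + y. If 8 remain, the many such
   quadruples, together with exchanges between pairs and remaining elements,
   force all the pair sums to be equal, which is absurd. If 6 remain, they form
   three couples {a_i, b_i} with the same sum a_i + b_i and 2(a_i + b_i) = x + y;
   exchanges show that S is supported on these six elements, with odd
   multiplicities. The number of couples with {2a_i, 2b_i} = {x, y} is 3, 2 or 1,
   which gives (s3), (s1) and (s2) respectively. *)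
Require Import Defs.
From HB Require Import structures.
From mathcomp Require Import all_boot all_order all_algebra all_fingroup all_solvable.
From mathcomp Require Import zify ring.

Set Implicit Arguments.
Unset Strict Implicit.
Unset Printing Implicit Defensive.

Import GRing.Theory.
Local Open Scope ring_scope.

(** * Multisets and blocks *)

(** Because a pair has length 2 and sum in 2G, completing m pairs by 2n - 2m remaining elements
    turns the absence of zero-sum subsequences of length 2n in G into a condition on m terms of a
    cyclic group of order n. Exchanges are effective for the following reason: replacing an element
    of a pair by a remaining element of the same class gives a configuration of the same kind, so
    every identity forced by the hypothesis holds before and after, and subtraction shows that the
    exchanged elements are equal. In the step n = km the same comparison lifts a congruence modulo k
    to one modulo km. The obstacle with 8 remaining elements is that only 2n - 3 pairs are left, one
    fewer than the inverse theorem requires. For the converse, the coefficients of f1 and f2 in a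
    zero sum must be even. In (s1) and (s2) this forces the terms with coefficients a and 1 - a (or
    b and 1 - b) to occur together or not at all, so that the coefficient of f3 becomes a number of
    terms smaller than 4n; it is thus 0 or 2n. In (s3) this coefficient is the number of chosen
    terms f3 + d_i. The odd multiplicities, or the condition on S', exclude both values. *)

Lemma perm_map_lift (T U : eqType) (f : T -> U) (s : seq T) (t : seq U) :
  perm_eq [seq f x | x <- s] t -> exists2 s', perm_eq s s' & t = [seq f x | x <- s'].
Proof.
case: s => [|x0 s]; first by rewrite perm_sym => /perm_nilP ->; exists [::].
set u := x0 :: s; rewrite perm_sym => /(perm_iotaP (f x0))[I pI ->].
exists [seq nth x0 u i | i <- I].
  rewrite perm_sym; apply/(perm_iotaP x0); exists I => //.
  by rewrite size_map in pI.
rewrite -map_comp; apply/eq_in_map => i.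
by rewrite (perm_mem pI) mem_iota size_map => /andP[_ ltiu]; exact: (nth_map x0).
Qed.

Lemma count_extract (T : eqType) (P : pred T) k (s : seq T) :
  (k <= count P s)%N ->
  exists t r, [/\ perm_eq s (t ++ r), all P t & size t = k].
Proof.
move=> lek; exists (take k (filter P s)).
exists (drop k (filter P s) ++ filter (predC P) s); split.
- by rewrite catA cat_take_drop perm_sym perm_filterC.
- by apply/allP => x /mem_take; rewrite mem_filter => /andP[].
- by rewrite size_takel // size_filter.
Qed.

Definition unpair (T : Type) (ps : seq (T * T)) : seq T :=
  flatten [seq [:: q.1; q.2] | q <- ps].

(** Equality of multisets is tested by counting with an arbitrary predicate: concatenation becomes
    addition, and a rearrangement becomes a linear identity between counts. *)
Ltac count_lia :=
  rewrite /unpair /=; repeat (rewrite count_cat /=); repeat match goal with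
    | |- context [nat_of_bool ?b] => move: (nat_of_bool b) => ?
    | |- context [count ?P ?s] => move: (count P s) => ? end; clear; lia.

Lemma size_unpair (T : Type) (ps : seq (T * T)) : size (unpair ps) = (2 * size ps)%N.
Proof. by elim: ps => //= q ps; rewrite /unpair /= => ->; rewrite mulnS. Qed.

Lemma unpair_cat (T : Type) (ps qs : seq (T * T)) :
  unpair (ps ++ qs) = unpair ps ++ unpair qs.
Proof. by rewrite /unpair map_cat flatten_cat. Qed.

Lemma perm_unpair (T : eqType) (ps qs : seq (T * T)) :
  perm_eq ps qs -> perm_eq (unpair ps) (unpair qs).
Proof. by move=> pq; apply/perm_flatten/perm_map. Qed.

Lemma sum_unpair (V : nmodType) (ps : seq (V * V)) :
  \sum_(x <- unpair ps) x = \sum_(q <- ps) (q.1 + q.2).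
Proof.
elim: ps => [|q ps IH]; rewrite ?big_nil // /unpair /= !big_cons -/(unpair ps) IH.
by rewrite addrA.
Qed.

(** After sorting along [ord], the i-th element is paired with the (i+k)-th; if they were equal, so
    would be the k + 1 elements between them, exceeding the bound on multiplicities. *)
Lemma pairing (T : eqType) (ord : T -> nat) (k : nat) (s : seq T) :
  injective ord -> size s = (2 * k)%N -> (forall x, count_mem x s <= k)%N ->
  exists ps, [/\ size ps = k, all (fun q => q.1 != q.2) ps & perm_eq s (unpair ps)].
Proof.
move=> inj_ord; case: k => [|k].
  by rewrite muln0 => /size0nil -> _; exists [::].
move=> sz cnt; have [x0 _] : exists x, x \in s.
  by case: s sz {cnt} => // x s _; exists x; rewrite inE eqxx.
pose le := relpre ord leq; pose u := sort le s.
have szu : size u = (2 * k.+1)%N by rewrite size_sort.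
have su : sorted le u by apply: sort_sorted => x y; apply: leq_total.
have pu : perm_eq u s by rewrite perm_sort.
have le_tr : transitive le by move=> x y z; apply: leq_trans.
have le_rf : reflexive le by move=> x; apply: leqnn.
exists (zip (take k.+1 u) (drop k.+1 u)).
have szt : size (take k.+1 u) = k.+1 by rewrite size_takel // szu; lia.
have szd : size (drop k.+1 u) = k.+1 by rewrite size_drop szu; lia.
split; first by rewrite size_zip szt szd minnn.
  apply/(all_nthP (x0, x0)) => i; rewrite size_zip szt szd minnn => lti.
  rewrite nth_zip ?szt ?szd //= nth_take // nth_drop; apply/eqP => E.
  have := cnt (nth x0 u i); rewrite -(seq.permP pu) leqNgt => /negP; apply.
  set P := pred1 _.
  have -> : count P u = (count P (take i u) +
      (count P (take k.+2 (drop i u)) + count P (drop k.+2 (drop i u))))%N.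
    by rewrite -!count_cat !cat_take_drop.
  suff -> : count P (take k.+2 (drop i u)) = k.+2 by lia.
  have szz : size (take k.+2 (drop i u)) = k.+2.
    by rewrite size_takel // size_drop szu; lia.
  rewrite -[RHS]szz; apply/eqP; rewrite -all_count.
  apply/(all_nthP x0) => j; rewrite szz => ltj.
  rewrite nth_take // nth_drop /=; apply/eqP/inj_ord/eqP; rewrite eqn_leq.
  have [h1 h2] : le (nth x0 u (i + j)) (nth x0 u (k.+1 + i)) /\
     le (nth x0 u i) (nth x0 u (i + j)).
    by split; apply: (sorted_leq_nth le_tr le_rf x0 su); rewrite ?inE ?szu; lia.
  by move: h1 h2; rewrite /le /= -E => -> ->.
rewrite -(seq.permPl pu) -{1}[u](cat_take_drop k.+1).
move: (take _ _) (drop _ _) szt szd => {szu su pu u cnt}v w.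
elim: (k.+1) v w {sz} => [|m IH] [|x v] [|y w] //= [] sv [] sw.
move/seq.permP: (IH v w sv sw) => E; apply/seq.permP => P; move: (E P).
count_lia.
Qed.

(** A predicate on the sum, instead of the condition of being 0, covers divisibility over the
    integers and prescribed sums in G alike. *)
Definition has_block (V : nmodType) (Z : pred V) (n : nat) (s : seq V) : Prop :=
  exists t r, [/\ perm_eq s (t ++ r), size t = n & Z (\sum_(x <- t) x)].

Lemma uniq_subset_sums2 (V : zmodType) (d1 d2 : V) :
  d1 != 0 -> d2 != 0 -> d1 != d2 -> d1 != - d2 -> uniq [:: 0; d1; d2; d1 + d2].
Proof.
move=> d10 d20 ne1 ne2; rewrite /= !inE !(eq_sym 0) !negb_or d10 d20 ne1 addr_eq0 ne2 /=.
by rewrite eq_sym -subr_eq0 addrC addKr d20 eq_sym -subr_eq0 addrK d10.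
Qed.

(** Blocks are prefixes of permutations of [s], of which there are finitely many, so the case
    distinction is decidable. *)
Lemma has_block_em (V : nmodType) (Z : pred V) (n : nat) (s : seq V) :
  has_block Z n s \/ ~ has_block Z n s.
Proof.
pose b := has (fun u => (size (take n u) == n) && Z (\sum_(x <- take n u) x)) (permutations s).
have bP : has_block Z n s <-> b.
  split=> [[t [r [pe st Zt]]]|/hasP[u]].
    apply/hasP; exists (t ++ r); first by rewrite mem_permutations perm_sym.
    by rewrite take_size_cat ?st ?eqxx.
  rewrite mem_permutations => pe /andP[/eqP st Zt].
  by exists (take n u), (drop n u); rewrite cat_take_drop perm_sym.
by case E: b; [left; apply/bP | right=> /bP; rewrite E].
Qed.

Lemma has_block_perm (V : nmodType) (Z : pred V) (n : nat) (s u : seq V) :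
  perm_eq s u -> has_block Z n s -> has_block Z n u.
Proof. by move=> pe [t [r [pt st Zt]]]; exists t, r; rewrite -(seq.permPl pe). Qed.

Lemma has_block_cat (V : nmodType) (Z : pred V) (n : nat) (s u : seq V) :
  has_block Z n s -> has_block Z n (s ++ u).
Proof.
move=> [t [r [pt st Zt]]]; exists t, (r ++ u); split=> //.
by rewrite catA perm_cat2r.
Qed.

(** * The inverse Erdos-Ginzburg-Ziv theorem in groups of prime order *)

Section PrimeField.
Variables (F : finComNzRingType) (p : nat).
Hypotheses (p1 : (1 < p)%N) (card_F : #|F| = p).
Hypothesis mulrn_p : forall d : F, d *+ p = 0.
Hypothesis mulrn_F : forall d x : F, d != 0 -> exists2 m, (m < p)%N & x = d *+ m.

(** Iterated from {0} over the differences of the pairs, this gives all their subset sums: the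
    amounts by which the sum of the first components changes when some pairs contribute their second
    component. *)
Definition add_choice (d : F) (A : {set F}) := A :|: [set d + x | x in A].

(** If nothing new appears, [A] is stable under translation by [d]; as [d] generates the additive
    group, [A] is everything. This is where primality of the order enters. *)
Lemma card_add_choice (d : F) (A : {set F}) :
  d != 0 -> A != set0 -> (minn p (#|A| + 1) <= #|add_choice d A|)%N.
Proof.
move=> d0 /set0Pn[x xA]; have sub : A \subset add_choice d A by apply: subsetUl.
have [lt|ge] := ltnP #|A| #|add_choice d A|; first by rewrite addn1 geq_min lt orbT.
have /eqP E : A == add_choice d A by rewrite eqEcard sub ge.
have cl y : y \in A -> d + y \in A.
  by move=> yA; rewrite E; apply/setUP; right; apply: imset_f.
suff AT : A = [set: F] by rewrite -E AT cardsT card_F geq_min leqnn.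
apply/setP => y; rewrite inE.
have [m _] := mulrn_F (y - x) d0; move/(canRL (subrK x)) => ->.
by elim: m => [|m IH]; rewrite ?add0r // mulrS -addrA cl.
Qed.

Lemma card_foldr_add_choice (ds : seq F) (A : {set F}) :
  all (fun d => d != 0) ds -> A != set0 ->
  (minn p (#|A| + size ds) <= #|foldr add_choice A ds|)%N /\
  foldr add_choice A ds != set0.
Proof.
move=> + A0; elim: ds => [|d ds IH] /=; first by rewrite addn0 geq_minr.
case/andP => d0 /IH[le n0]; split; last first.
  by apply: contraNneq n0 => E; rewrite -subset0 -E subsetUl.
by apply: leq_trans (card_add_choice d0 n0); move: le; set c1 := #|_|; lia.
Qed.

Lemma choose_from_pairs (ps : seq (F * F)) x :
  x \in foldr add_choice [set 0] [seq q.2 - q.1 | q <- ps] ->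
  exists t r, [/\ perm_eq (unpair ps) (t ++ r), size t = size ps &
                \sum_(y <- t) y = \sum_(q <- ps) q.1 + x].
Proof.
elim: ps x => [|[a b] ps IH] x /=.
  by rewrite inE => /eqP ->; exists [::], [::]; rewrite !big_nil addr0.
case/setUP => [/IH|/imsetP[y /IH]] [t [r [pe st E]]].
  exists (a :: t), (b :: r); split => //=; rewrite ?st //; last first.
    by rewrite !big_cons E addrA.
  by move/seq.permP: pe => pe; apply/seq.permP => P; move: (pe P); count_lia.
move=> ->; exists (b :: t), (a :: r); split => //=; rewrite ?st //; last first.
  by rewrite !big_cons E /=; ring.
by move/seq.permP: pe => pe; apply/seq.permP => P; move: (pe P); count_lia.
Qed.

(* A pair taken entirely, together with one element of each other pair, has
   length p; so the choices from the other pairs cannot reach everything. *)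
Lemma no_block_choices (q : F * F) (ps : seq (F * F)) :
  size ps = (p - 2)%N -> ~ has_block (pred1 0) p (unpair (q :: ps)) ->
  - (q.1 + q.2 + \sum_(r <- ps) r.1) \notin
     foldr add_choice [set 0] [seq r.2 - r.1 | r <- ps].
Proof.
move=> sp nb; apply/negP => /choose_from_pairs[t [r [pe st E]]]; apply: nb.
exists (q.1 :: q.2 :: t), r; split.
- by rewrite /unpair /= !perm_cons.
- by move: p1; rewrite /= st sp; lia.
- by rewrite /= !big_cons E; apply/eqP; ring.
Qed.

(** If d1 differs from d2 and -d2, the first two pairs already give the four sums 0, d1, d2, d1 +
    d2, one more than the general bound. Each of the p - 4 further pairs adds at least one, so
    everything is reached, against [no_block_choices]. *)
Lemma no_block_diff (q1 q2 q3 : F * F) (ps : seq (F * F)) :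
  all (fun q => q.1 != q.2) (q1 :: q2 :: q3 :: ps) -> size ps = (p - 4)%N -> (4 <= p)%N ->
  ~ has_block (pred1 0) p (unpair [:: q1, q2, q3 & ps]) ->
  let d1 := q1.2 - q1.1 in let d2 := q2.2 - q2.1 in d1 = d2 \/ d1 = - d2.
Proof.
move=> /= /and4P[n1 n2 n3 nps] sp p4 nb.
set d1 := q1.2 - q1.1; set d2 := q2.2 - q2.1.
have [->|ne1] := eqVneq d1 d2; first by left.
have [->|ne2] := eqVneq d1 (- d2); first by right.
have d10 : d1 != 0 by rewrite subr_eq0 eq_sym.
have d20 : d2 != 0 by rewrite subr_eq0 eq_sym.
(* [q3] is the pair taken entirely; [foldr] starts from the end of the list, so [q1] and [q2] are
   moved there to be combined first. *)
exfalso; apply: (negP (@no_block_choices q3 (ps ++ [:: q1; q2]) _ _)).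
- by rewrite size_cat /= sp; lia.
- move=> [t [r [pe st Z]]]; apply: nb; exists t, r; split => //.
  by rewrite -(seq.permPr pe); apply: perm_unpair; apply: (permEl (perm_catC [:: q1; q2] (q3 :: ps))).
rewrite map_cat foldr_cat /= -/d1 -/d2.
set A := add_choice d1 _; suff -> : foldr add_choice A [seq r.2 - r.1 | r <- ps] = setT.
  by rewrite inE.
have cA : (4 <= #|A|)%N.
  have u : uniq [:: 0; d1; d2; d1 + d2].
    exact: uniq_subset_sums2.
  rewrite -[4%N]/(size [:: 0; d1; d2; d1 + d2]) -(card_uniqP u).
  apply/subset_leq_card/subsetP => y.
  rewrite /A /add_choice !inE.
  case/or4P => /eqP ->; rewrite ?eqxx //; apply/orP.
  - by right; apply/imsetP; exists 0; rewrite ?addr0 // !inE eqxx.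
  - by left; apply/orP; right; apply/imsetP; exists 0; rewrite ?addr0 // !inE eqxx.
  right; apply/imsetP; exists d2 => //; rewrite !inE; apply/orP; right.
  by apply/imsetP; exists 0; rewrite ?addr0 // !inE eqxx.
have A0 : A != set0 by rewrite -card_gt0; lia.
have dn : all (fun d => d != 0) [seq r.2 - r.1 | r <- ps].
  by rewrite all_map; apply: sub_all nps => r /=; rewrite subr_eq0 eq_sym.
have [le _] := card_foldr_add_choice dn A0.
apply/eqP; rewrite eqEcard subsetT cardsT card_F -[X in (X <= _)%N]minnn.
apply: leq_trans le; rewrite size_map sp; move: cA p4; set c := #|_|; clear; lia.
Qed.

Lemma mulrn_choices (d : F) k m :
  (k <= m)%N -> d *+ k \in foldr add_choice [set 0] (nseq m d).
Proof.
elim: m k => [|m IH] [|k] //=; rewrite ?inE ?mulr0n // => le; apply/orP.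
  by left; apply: (IH 0%N).
by right; apply/imsetP; exists (d *+ k); rewrite ?IH // mulrS.
Qed.

(** When all differences are d or -d, the pairs can be oriented as (t, t + d). With one pair taken
    entirely, the p - 2 others reach the multiples 0, ..., (p-2)d and miss only -d. So the forbidden
    value is exactly that one, which expresses t by the sum T of all first components: t = -T for
    every pair. *)
Lemma egz_inverse_prime_order (s : seq F) :
  size s = (2 * (p - 1))%N -> ~ has_block (pred1 0) p s ->
  exists x y, [/\ x != y, count_mem x s = (p - 1)%N & count_mem y s = (p - 1)%N].
Proof.
move=> sz nb.
have cnt x : (count_mem x s <= p - 1)%N.
  rewrite leqNgt; apply/negP => lt; apply: nb.
  have [|t [r [pe /all_pred1P Et st]]] := @count_extract _ (pred1 x) p s.
    by move: lt; lia.
  rewrite st in Et; exists t, r; split => //.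
  by rewrite Et big_nseq iter_addr_0 mulrn_p /=.
have [ps [sp ne pe]] := pairing (inj_comp val_inj (@enum_rank_inj F)) sz cnt.
have nbp : ~ has_block (pred1 0) p (unpair ps).
  by case=> t [r [pe' st Z]]; apply: nb; exists t, r; rewrite (seq.permPl pe).
have [q0 q0in] : exists q, q \in ps.
  by case: (ps) sp => [|q ps']; [move=> /=; lia | exists q; rewrite inE eqxx].
pose d := q0.2 - q0.1.
have d0 : d != 0 by rewrite subr_eq0 eq_sym; apply: (allP ne).
have diffs q : q \in ps -> q.2 - q.1 = d \/ q.2 - q.1 = - d.
  move=> qin; have [->|neq] := eqVneq q q0; first by left.
  have pr := perm_to_rem q0in.
  have qin' : q \in rem q0 ps by move: qin; rewrite (perm_mem pr) inE (negbTE neq).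
  have pr' := perm_to_rem qin'.
  have pq : perm_eq ps (q :: q0 :: rem q (rem q0 ps)).
    move/seq.permP: pr => pr; move/seq.permP: pr' => pr'; apply/seq.permP => P.
    by move: (pr P) (pr' P); count_lia.
  move: (rem q _) pq => ps' pq {pr pr' qin'}.
  have sp' : size ps' = (p - 3)%N by move: (perm_size pq); rewrite sp /=; lia.
  have [->|ne1] := eqVneq (q.2 - q.1) d; first by left.
  have [->|ne2] := eqVneq (q.2 - q.1) (- d); first by right.
  have dq0 : q.2 - q.1 != 0 by rewrite subr_eq0 eq_sym; apply: (allP ne).
  (* A third pair is needed to apply [no_block_diff]; it exists because 0, d, -d and the new
     difference are four distinct elements. If d = -d, the only multiples of d would be 0 and d, and
     the new difference would be one of them. *)
  have p4 : (4 <= p)%N.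
    have u : uniq [:: 0; q.2 - q.1; d; - d].
      rewrite /= !inE !(eq_sym 0) !negb_or oppr_eq0 d0 dq0 ne1 ne2 /= andbT.
      apply/eqP => dd; have [m2] : exists2 m, (m < p)%N & q.2 - q.1 = d *+ m.
        exact: mulrn_F.
      have {}dd : d *+ 2 = 0 by rewrite mulr2n {1}dd addNr.
      rewrite -[m2]odd_double_half mulrnDr -muln2 mulnC mulrnA dd mul0rn addr0.
      by case: odd => _ E; [move: ne1; rewrite E eqxx | move: dq0; rewrite E eqxx].
    by have := max_card (mem [:: 0; q.2 - q.1; d; - d]); rewrite card_F (card_uniqP u).
  case: ps' sp' pq => [|q3 ps'] sp' pq; first by move: sp' p4; clear => /=; lia.
  have := @no_block_diff q q0 q3 ps'; rewrite -/d; apply=> //.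
  - by rewrite -(perm_all _ pq).
  - by move: sp'; clear => /=; lia.
  case=> t [r [pe' st Z]]; apply: nbp; exists t, r; split => //.
  by rewrite -(seq.permPr pe'); apply: perm_unpair.
have [ts [pt st]] : exists ts : seq F,
    perm_eq s (unpair [seq (t, t + d) | t <- ts]) /\ size ts = (p - 1)%N.
  exists [seq if q.2 - q.1 == d then q.1 else q.2 | q <- ps]; split; last by rewrite size_map.
  rewrite (seq.permPl pe) -map_comp {pe nbp q0in sp}; elim: ps diffs {ne} => //= q ps IH diffs.
  have /seq.permP E : perm_eq _ _ := IH (fun r rin => diffs r (@mem_behead _ (q :: ps) r rin)).
  have {diffs}D := diffs q (mem_head _ _).
  apply/seq.permP => P; move: (E P); rewrite /unpair /= => ->.
  case: eqP D => [<- _|ne [] // D]; first by rewrite (addrC q.1) subrK.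
  have -> : d = q.1 - q.2 by rewrite -[d]opprK -D opprB.
  by rewrite (addrC q.2) subrK; count_lia.
pose T := \sum_(t <- ts) t.
have tT t : t \in ts -> t = - T.
  move=> tin; have pr := perm_to_rem tin.
  have ET : T = t + \sum_(u <- rem t ts) u by rewrite /T (perm_big _ pr) big_cons.
  have szr : size (rem t ts) = (p - 2)%N by move: (perm_size pr); rewrite st /=; lia.
  have := @no_block_choices (t, t + d) [seq (u, u + d) | u <- rem t ts].
  rewrite size_map => /(_ szr) H.
  have {}H : - (t + (t + d) + \sum_(u <- rem t ts) u) \notin
       foldr add_choice [set 0] (nseq (p - 2) d).
    move: H; rewrite big_map -map_comp /=.
    have -> : [seq u + d - u | u <- rem t ts] = nseq (p - 2) d.
      by rewrite -szr; elim: (rem t ts) => //= u us ->; rewrite addrC addKr.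
    apply; case=> u [r [pe' su Z]]; apply: nb; exists u, r; split => //.
    rewrite (seq.permPl pt) -(seq.permPr pe'); apply: perm_unpair.
    exact: (perm_map (fun t => (t, t + d)) pr).
  have [m ltm E] := mulrn_F (- (t + T)) d0.
  case: m ltm E => [|m] ltm E.
    by move/eqP: E; rewrite mulr0n oppr_eq0 addr_eq0 => /eqP.
  case/negP: H; have -> : - (t + (t + d) + \sum_(u <- rem t ts) u) = d *+ m.
    by have := E; rewrite ET mulrS => H; apply: (addrI d); rewrite -H; ring.
  by apply: mulrn_choices; move: ltm; lia.
have Ets : ts = nseq (p - 1) (- T) by rewrite -st; apply/all_pred1P/allP => t /tT ->; apply/eqP.
exists (- T), (- T + d); rewrite !(seq.permP pt) {1 2}Ets map_nseq; move: (- T) => x.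
have ne1 : x + d != x by rewrite -subr_eq0 addrAC addrN add0r.
have cu P y z m : count P (unpair (nseq m (y, z))) = (m * P y + m * P z)%N.
  by elim: m => //= m IH; rewrite /unpair /= -/(unpair _) IH !mulSn; lia.
have ne2 : (x == x + d) = false by rewrite eq_sym (negbTE ne1).
by split; rewrite ?cu /= ?eqxx ?ne2 ?(negbTE ne1) ?muln0 ?muln1 ?addn0.
Qed.
End PrimeField.

(** * Cyclic groups of composite order *)

Lemma count_extract2 (T : eqType) (P Q : pred T) a b (s : seq T) :
  (forall x, P x -> Q x -> False) -> (a <= count P s)%N -> (b <= count Q s)%N ->
  exists t1 t2 r, [/\ perm_eq s (t1 ++ t2 ++ r), all P t1, all Q t2,
                      size t1 = a & size t2 = b].
Proof.
move=> dis /count_extract[t1 [r1 [p1 a1 s1]]] leb.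
have c0 : count Q t1 = 0%N.
  apply/eqP; rewrite -leqn0 leqNgt -has_count; apply/hasPn => x xt; apply/negP => Qx.
  by have := dis x (allP a1 x xt) Qx.
have [|t2 [r2 [p2 a2 s2]]] := @count_extract _ Q b r1.
  by move: leb; rewrite (seq.permP p1) count_cat c0.
by exists t1, t2, r2; split=> //; rewrite (permPl p1) perm_cat2l.
Qed.

Lemma all_of_count2 (T : eqType) (P Q : pred T) (s : seq T) :
  (forall x, P x -> Q x -> False) -> (count P s + count Q s = size s)%N ->
  forall x, x \in s -> P x || Q x.
Proof.
move=> dis; rewrite -count_predUI (eq_count (a2 := pred0) (a1 := predI P Q)); last first.
  by move=> x /=; apply/negP => /andP[Px Qx]; apply: (dis x).
by rewrite count_pred0 addn0 => /eqP; rewrite -all_count => /allP.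
Qed.

(** Residues are handled through integers rather than in a quotient, so that a block sum divisible
    by k can be divided by k when passing from km to m. *)
Definition divides (n : nat) : pred int := fun z => (n%:Z %| z)%Z.
Definition congr_to (n : nat) (x : int) : pred int := fun z => (n%:Z %| z - x)%Z.

Definition egz (n : nat) := forall s : seq int,
  size s = (2 * n - 1)%N -> has_block (divides n) n s.

Definition egz_inverse (n : nat) := forall s : seq int,
  size s = (2 * (n - 1))%N -> ~ has_block (divides n) n s ->
  exists x y, [/\ coprimez (y - x) n, count (congr_to n x) s = (n - 1)%N &
                  count (congr_to n y) s = (n - 1)%N].

Lemma sum_congr_to n x (t : seq int) :
  all (congr_to n x) t -> (n %| \sum_(z <- t) z - (size t)%:Z * x)%Z.
Proof.
elim: t => [|z t IH] /=; first by rewrite big_nil mul0r subr0 dvdz0.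
case/andP=> zx /IH; rewrite big_cons => IH'.
have -> : z + \sum_(j <- t) j - (size t).+1%:Z * x
   = (z - x) + (\sum_(j <- t) j - (size t)%:Z * x) by lia.
by exact: rpredD.
Qed.

Lemma congr_to_dis n x y z : (1 < n)%N -> coprimez (y - x) n ->
  congr_to n x z -> congr_to n y z -> False.
Proof.
rewrite /congr_to => n1 cop cx cy; have : (n %| y - x)%Z.
  have -> : y - x = (z - x) - (z - y) by lia.
  exact: rpredB.
move: cop; rewrite coprimez_sym /coprimez => /eqP g /gcdz_idPl.
by rewrite g; lia.
Qed.

Lemma congr_toC n x y : congr_to n x y = congr_to n y x.
Proof. by rewrite /congr_to -[x - y]opprB !dvdzE abszN. Qed.

Lemma congr_to_trans n x y z : congr_to n x y -> congr_to n y z -> congr_to n x z.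
Proof.
rewrite /congr_to => h1 h2.
have -> : z - x = (z - y) + (y - x) by lia.
exact: rpredD.
Qed.

Lemma congr_to_dvd d n x y : (d %| n)%N -> congr_to n x y -> congr_to d x y.
Proof. by move=> dn; apply: dvdz_trans. Qed.

Lemma solve_linear_mod (n : nat) (c d : int) : (0 < n)%N -> coprimez d n ->
  exists2 j, (j < n)%N & (n %| c - j%:Z * d)%Z.
Proof.
move=> n0 /coprimezP[[u v] /= E].
have nz : n%:Z != 0 by lia.
have := modz_ge0 (c * u) nz; have := ltz_pmod (c * u) (_ : 0 < n%:Z).
case: (c * u %% n)%Z (divz_eq (c * u) n) => // j Ej lt _.
exists j; first by have := lt _; lia.
apply/dvdzP; exists (c * v + (c * u %/ n)%Z * d).
have -> : j%:Z = c * u - (c * u %/ n)%Z * n by rewrite {1}Ej; ring.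
by rewrite -{1}[c]mulr1 -E; ring.
Qed.

(** Otherwise c is congruent to x + (j+1)(y - x) with 0 < j + 1 < n, and c together with j terms
    congruent to x and n - j - 1 terms congruent to y has length n and sum congruent to n y. Hence
    one term of an extremal sequence is determined by the others. *)
Lemma one_more_mod n x y c (s : seq int) : (0 < n)%N -> coprimez (y - x) n ->
  (n - 2 <= count (congr_to n x) s)%N -> (n - 1 <= count (congr_to n y) s)%N ->
  ~ has_block (divides n) n (c :: s) -> congr_to n x c.
Proof.
move=> n0 cop cx cy nb; have [n1|n1] := eqVneq n 1%N; first by rewrite n1 /congr_to dvd1z.
have [[|j] ltj D] := solve_linear_mod (c - x) n0 cop.
  by move: D; rewrite mul0r subr0.
case: nb; have [|||t1 [t2 [r [pe a1 a2 s1 s2]]]] :=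
    @count_extract2 _ (congr_to n x) (congr_to n y) j (n - j.+1) s.
- by move=> z; apply: congr_to_dis cop; lia.
- by apply: leq_trans cx; lia.
- by apply: leq_trans cy; lia.
exists (c :: t1 ++ t2), r; split.
- by rewrite /= perm_cons -catA.
- by rewrite /= size_cat s1 s2; lia.
have := sum_congr_to a1; have := sum_congr_to a2; rewrite s1 s2 /divides big_cons big_cat /=.
have -> : (n - j.+1)%:Z = n%:Z - j%:Z - 1 by lia.
move: D => /dvdzP[q1 D] /dvdzP[q2 D2] /dvdzP[q3 D3].
apply/dvdzP; exists (q1 + q2 + q3 + y).
rewrite (_ : c = q1 * n + x + j.+1%:Z * (y - x)); last by rewrite -D; ring.
rewrite (_ : bigop _ _ _ = q3 * n + j%:Z * x); last by rewrite -D3; ring.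
rewrite (_ : bigop _ _ _ = q2 * n + (n%:Z - j%:Z - 1) * y); last by rewrite -D2; ring.
have -> : j.+1%:Z = j%:Z + 1 by lia.
ring.
Qed.

(** Without a block, deleting one term c leaves a two-valued extremal sequence with n - 1 copies of
    each residue, and c would have to be congruent to both. *)
Lemma egz_of_inverse n : (0 < n)%N -> egz_inverse n -> egz n.
Proof.
move=> n0 inv [|c s] /= sz; first by lia.
have [n1|n1] := eqVneq n 1%N.
  by exists [:: c], s; rewrite cat1s perm_refl n1 /divides dvd1z.
case: (has_block_em (divides n) n (c :: s)) => // nb; have [||x [y [cop cx cy]]] := inv s; first by lia.
  move=> bl; apply: nb; apply: has_block_perm (has_block_cat [:: c] bl).
  by rewrite cats1 perm_rcons.
have cop' : coprimez (x - y) n by rewrite -opprB /coprimez gcdNz.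
exfalso; apply: (congr_to_dis (n := n) (z := c) _ cop); first by lia.
  by apply: (one_more_mod n0 cop _ _ nb); rewrite ?cx ?cy //; lia.
by apply: (one_more_mod n0 cop' _ _ nb); rewrite ?cx ?cy //; lia.
Qed.

Definition is_block (k : nat) (b : seq int) :=
  (size b == k) && (k%:Z %| \sum_(z <- b) z)%Z.

(** Each extraction consumes k terms and needs 2k - 1 of them; the bound leaves exactly k + k - 1
    for the last one. *)
Lemma extract_blocks k j (s : seq int) : (0 < k)%N -> egz k ->
  (k * j + k - 1 <= size s)%N ->
  exists Bs r, [/\ perm_eq s (flatten Bs ++ r), size Bs = j & all (is_block k) Bs].
Proof.
move=> k0 ek; elim: j s => [|j IH] s; first by exists [::], s.
rewrite mulnS => les.
have ltk : (2 * k - 1 <= size s)%N by move: les; move: (k * j)%N => ?; lia.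
have [|t [r [pe st Zt]]] := ek (take (2 * k - 1) s); first by rewrite size_takel.
have szr : (size r = k - 1)%N.
  by have := perm_size pe; rewrite size_cat size_takel ?st //; lia.
have [|Bs [r' [pe' sB aB]]] := IH (r ++ drop (2 * k - 1) s).
  by rewrite size_cat size_drop szr; move: les ltk; move: (k * j)%N => ?; lia.
exists (t :: Bs), r'; split=> /=; rewrite ?sB // ?aB ?andbT; last by rewrite /is_block st eqxx.
by rewrite -catA -[s](cat_take_drop (2 * k - 1)) (permPl (perm_cat pe (perm_refl _)))
  -catA perm_cat2l.
Qed.

Lemma size_flatten_blocks k (Bs : seq (seq int)) :
  all (is_block k) Bs -> size (flatten Bs) = (k * size Bs)%N.
Proof.
elim: Bs => [|b Bs IH] /=; first by rewrite muln0.
by case/andP => /andP[/eqP sb _] /IH; rewrite size_cat sb => ->; rewrite mulnS.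
Qed.

Lemma combine_blocks k m (s : seq int) (Bs : seq (seq int)) r :
  perm_eq s (flatten Bs ++ r) -> all (is_block k) Bs ->
  has_block (divides m) m [seq divz (\sum_(z <- b) z) k | b <- Bs] ->
  has_block (divides (k * m)) (k * m) s.
Proof.
move=> pe aB [t [r' [pt st Zt]]].
have [Bs' pB E] := perm_map_lift pt.
have [E1 E2] : t = [seq divz (\sum_(z <- b) z) k | b <- take m Bs'] /\ (m <= size Bs')%N.
  split; first by rewrite map_take -E take_size_cat.
  by rewrite -(size_map (fun b : seq int => divz (\sum_(z <- b) z) k)) -E size_cat st leq_addr.
have aT : all (is_block k) (take m Bs').
  apply/allP => b /mem_take; rewrite -(perm_mem pB); exact: (allP aB).
exists (flatten (take m Bs')), (flatten (drop m Bs') ++ r); split.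
- by rewrite catA -flatten_cat cat_take_drop (permPl pe) perm_cat2r perm_flatten.
- by rewrite (size_flatten_blocks aT) size_takel.
have -> : \sum_(z <- flatten (take m Bs')) z = k%:Z * \sum_(z <- t) z.
  rewrite E1; elim: (take m Bs') aT => [|b T IH] /=; first by rewrite !big_nil mulr0.
  case/andP=> /andP[_ /divzK D] /IH; rewrite big_cat big_cons mulrDr => <-.
  by rewrite mulrC D.
by rewrite /divides PoszM; apply: dvdz_mul.
Qed.

Section Composite.
Variables k m : nat.
Hypotheses (k1 : (1 < k)%N) (m1 : (1 < m)%N) (ek : egz k) (em : egz m).
Hypotheses (ik : egz_inverse k) (im : egz_inverse m).

Variable s : seq int.
Hypothesis sz : size s = (2 * (k * m - 1))%N.
Hypothesis nb : ~ has_block (divides (k * m)) (k * m) s.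

(** The number 2(m-1) of blocks is the largest possible by [few_blocks], and 2(k-1) terms are left:
    the inverse theorem applies to the quotients of the block sums modulo m and to the rest modulo
    k. *)
Definition decomposition (Bs : seq (seq int)) (r : seq int) :=
  [/\ perm_eq s (flatten Bs ++ r), size Bs = (2 * (m - 1))%N & all (is_block k) Bs].

Lemma decomposition_size Bs r : decomposition Bs r -> size r = (2 * (k - 1))%N.
Proof.
case=> pe sB aB; have := perm_size pe; rewrite size_cat (size_flatten_blocks aB) sB sz.
have -> : (k * (2 * (m - 1)) = 2 * (k * m) - 2 * k)%N by rewrite mulnCA mulnBr muln1 mulnBr.
by have := leq_pmulr k (ltnW m1); move: (k * m)%N (size r) k1 => M R; clear; lia.
Qed.

Lemma few_blocks Bs r : perm_eq s (flatten Bs ++ r) -> all (is_block k) Bs ->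
  (size Bs < 2 * m - 1)%N.
Proof.
move=> pe aB; rewrite ltnNge; apply/negP => le; apply: nb.
apply: (@combine_blocks k m s (take (2 * m - 1) Bs) (flatten (drop (2 * m - 1) Bs) ++ r)).
- by rewrite catA -flatten_cat cat_take_drop.
- by apply/allP => b /mem_take; apply: (allP aB).
by apply: em; rewrite size_map size_takel.
Qed.

Lemma rest_no_block Bs r : decomposition Bs r -> ~ has_block (divides k) k r.
Proof.
case=> pe sB aB [t [r' [pr st Zt]]].
suff : (size (t :: Bs) < 2 * m - 1)%N by rewrite /= sB; lia.
apply: (@few_blocks _ r'); last by rewrite /= aB /is_block st eqxx andbT.
rewrite (permPl pe) /= perm_sym -catA perm_catCA perm_cat2l perm_sym.
exact: pr.
Qed.

Lemma quotients_no_block Bs r : decomposition Bs r ->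
  ~ has_block (divides m) m [seq divz (\sum_(z <- b) z) k | b <- Bs].
Proof. by case=> pe sB aB /(combine_blocks pe aB)/nb. Qed.

Lemma rest_two_valued Bs r : decomposition Bs r -> exists x y,
  [/\ coprimez (y - x) k, count (congr_to k x) r = (k - 1)%N &
      count (congr_to k y) r = (k - 1)%N].
Proof. by move=> D; apply: ik (decomposition_size D) (rest_no_block D). Qed.

Lemma decomposition_perm Bs r Bs' r' : perm_eq Bs Bs' -> perm_eq r r' ->
  decomposition Bs r -> decomposition Bs' r'.
Proof.
move=> pB pr [pe sB aB]; split; last by rewrite -(perm_all _ pB).
  by rewrite (permPl pe) perm_cat // perm_flatten.
by rewrite -(perm_size pB).
Qed.

Lemma sum_block_congr x (b : seq int) :
  size b = k -> all (congr_to k x) b -> is_block k b.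
Proof.
move=> sb ab; rewrite /is_block sb eqxx /=; have := sum_congr_to ab; rewrite sb => h.
rewrite -[X in (_ %| X)%Z](subrK (k%:Z * x)).
by apply: rpredD h _; apply: dvdz_mulr.
Qed.

(* If z were a third residue, a block through z inside r + z exchanges b for
   r, and comparing the residues before and after shows that b + r splits off
   two disjoint constant blocks. *)
Lemma no_third_residue b Bs r x y z : decomposition (b :: Bs) r ->
  coprimez (y - x) k ->
  count (congr_to k x) r = (k - 1)%N -> count (congr_to k y) r = (k - 1)%N ->
  z \in b -> congr_to k x z || congr_to k y z.
Proof.
move=> D cop cx cy zb; apply/negPn/negP; rewrite negb_or => /andP[nx ny].
have dis u : congr_to k x u -> congr_to k y u -> False by apply: congr_to_dis.
have szr := decomposition_size D; have nbr := rest_no_block D.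
have rxy u : u \in r -> congr_to k x u || congr_to k y u.
  by apply: all_of_count2 => //; rewrite cx cy szr mul2n addnn.
have pb := perm_to_rem zb; move: (rem z b) pb => b' pb.
have [t [r1 [pt st Zt]]] := ek (s := z :: r) ltac:(rewrite /= szr; lia).
have zt : z \in t.
  apply/negPn/negP => zt; have zr1 : z \in r1.
    by have := perm_mem pt z; rewrite mem_cat (negbTE zt) inE eqxx /= => <-.
  apply: nbr; exists t, (rem z r1); split=> //.
  rewrite -(perm_cons z) (permPl pt) perm_sym -cat1s perm_catCA perm_cat2l cat1s perm_sym.
  exact: perm_to_rem.
have pt' := perm_to_rem zt; move: (rem z t) pt' => t' pt'.
have pr : perm_eq r (t' ++ r1).
  by rewrite -(perm_cons z) (permPl pt) -cat_cons perm_cat2r.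
have st' : size t' = (k - 1)%N by have := perm_size pt'; rewrite st /=; lia.
have [pe sB aB] := D; have /= /andP[/andP[/eqP sb Zb] aBs] := aB.
have D' : decomposition (t :: Bs) (b' ++ r1).
  split=> //; last by rewrite /= aBs /is_block st eqxx /= andbT.
  move/seq.permP: pe => pe; move/seq.permP: pb => pb; move/seq.permP: pr => pr.
  move/seq.permP: pt' => pt'; apply/seq.permP => P; move: (pe P) (pb P) (pr P) (pt' P).
  by count_lia.
have ct : (count (congr_to k x) t' + count (congr_to k y) t' = k - 1)%N.
  rewrite -st' -count_predUI (eq_count (a2 := pred0) (a1 := predI _ _)); last first.
    by move=> u; apply/negP => /andP[xu yu]; apply: (dis u).
  rewrite count_pred0 addn0; apply/eqP; rewrite -all_count; apply/allP => u ut.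
  by apply: rxy; rewrite (perm_mem pr) mem_cat ut.
(* If t' were constant of residue v, then z + (k-1)v would be divisible by k, that is, z congruent
   to v. *)
have lt_t v : ~~ congr_to k v z ->
   (count (congr_to k v) t' < k - 1)%N.
  move=> nv; rewrite ltn_neqAle -{2}st' count_size andbT; apply/eqP => E.
  have at' : all (congr_to k v) t' by rewrite all_count E st'.
  case/negP: nv; have := sum_congr_to at'; move: Zt; rewrite st' /divides (perm_big _ pt') big_cons.
  set S := bigop _ _ _ => h1 h2; rewrite /congr_to.
  have -> : z - v = (z + S) - (S - (k - 1)%:Z * v) - k%:Z * v.
    rewrite -subzn ?(ltnW k1) //; ring.
  by apply: rpredB (rpredB h1 h2) _; apply: dvdz_mulr.
have ltx := lt_t x nx.
have lty := lt_t y ny.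
have crx := cx; have cry := cy; rewrite !(seq.permP pr) !count_cat in crx cry.
have [x' [y' [cop' cx' cy']]] := rest_two_valued D'.
have szr' := decomposition_size D'.
have rxy' u : u \in b' ++ r1 -> congr_to k x' u || congr_to k y' u.
  by apply: all_of_count2; [move=> w; apply: congr_to_dis | rewrite cx' cy' szr' mul2n addnn].
(* A term of residue v survives in r1, so v is one of the two residues of the new rest and has
   multiplicity k - 1 there. *)
have ex_r1 v : (count (congr_to k v) t' < k - 1)%N ->
    (count (congr_to k v) t' + count (congr_to k v) r1 = k - 1)%N ->
    count (congr_to k v) (b' ++ r1) = (k - 1)%N.
  move=> h1 h2; have : has (congr_to k v) r1 by rewrite has_count; move: h1 h2; clear; lia.
  case/hasP => u ur vu; have := rxy' u; rewrite mem_cat ur orbT => /(_ isT).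
  have cong v' : congr_to k v' u -> congr_to k v =1 congr_to k v'.
    move=> v'u w; apply/idP/idP => h.
      by apply: congr_to_trans v'u (congr_to_trans _ h); rewrite congr_toC.
    by apply: congr_to_trans vu (congr_to_trans _ h); rewrite congr_toC.
  by case/orP => /cong E; rewrite (eq_count E).
have bx := ex_r1 x ltx crx; have by_ := ex_r1 y lty cry.
rewrite !count_cat in bx by_.
(* Comparing the old and the new rest, b' contains x and y as often as t', and each at least once;
   with the k - 1 copies in r this gives k copies of each residue, hence two blocks where only one
   was available. *)
have [|||X [Y [q [pq aX aY sX sY]]]] :=
  @count_extract2 _ (congr_to k x) (congr_to k y) k k (b ++ r).
- by move=> u; apply: congr_to_dis.
- by rewrite (seq.permP (perm_cat pb pr)) /= !count_cat; move: bx by_ ct ltx lty; clear; lia.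
- by rewrite (seq.permP (perm_cat pb pr)) /= !count_cat; move: bx by_ ct ltx lty; clear; lia.
suff : (size (X :: Y :: Bs) < 2 * m - 1)%N by move: sB m1; clear => /=; lia.
apply: (@few_blocks _ q).
  move/seq.permP: pe => pe; move/seq.permP: pq => pq; apply/seq.permP => P.
  by move: (pe P) (pq P); count_lia.
by rewrite /= (sum_block_congr sX aX) (sum_block_congr sY aY).
Qed.

(** With i terms of residue x and k - i of residue y, the block sum is congruent to i(x - y), so k
    divides i. *)
Lemma constant_block b Bs r x y : decomposition (b :: Bs) r -> coprimez (y - x) k ->
  count (congr_to k x) r = (k - 1)%N -> count (congr_to k y) r = (k - 1)%N ->
  all (congr_to k x) b \/ all (congr_to k y) b.
Proof.
move=> D cop cx cy; have xy z := no_third_residue (z := z) D cop cx cy.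
have [_ _ /= /andP[/andP[/eqP sb Zb] _]] := D.
have dis u : congr_to k x u -> congr_to k y u -> False by apply: congr_to_dis.
have tot : (count (congr_to k x) b + count (congr_to k y) b = k)%N.
  rewrite -[RHS]sb -count_predUI (eq_count (a2 := pred0) (a1 := predI _ _)); last first.
    by move=> u; apply/negP => /andP[xu yu]; apply: (dis u).
  by rewrite count_pred0 addn0; apply/eqP; rewrite -all_count; apply/allP.
have [t1 [t2 [q [pq a1 a2 s1 s2]]]] :=
  @count_extract2 _ (congr_to k x) (congr_to k y) _ _ b dis (leqnn _) (leqnn _).
have q0 : q = [::].
  apply/nilP; rewrite /nilp; have := perm_size pq; rewrite !size_cat s1 s2 sb.
  by rewrite addnA tot -{1}[k]addn0 => /addnI <-.
move: Zb; rewrite (perm_big _ pq) /= q0 cats0 big_cat /= => Zb.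
have := sum_congr_to a1; have := sum_congr_to a2; rewrite s1 s2.
move: Zb tot; set S1 := bigop _ _ _; set S2 := bigop _ _ _.
set i := count _ b; set j := count _ b => Zb tot h2 h1.
have : (k %| i%:Z * (y - x))%Z.
  have -> : i%:Z * (y - x) = (S1 - i%:Z * x) + (S2 - j%:Z * y) - (S1 + S2) + k%:Z * y.
    rewrite -tot PoszD; ring.
  by apply: rpredD; [apply: rpredB => //; apply: rpredD | apply: dvdz_mulr].
rewrite Gauss_dvdzl 1?coprimez_sym // dvdzE /= => ki.
have [i0|ipos] := posnP i.
  by right; rewrite all_count -/j sb -tot i0.
left; rewrite all_count -/i sb eqn_leq (dvdn_leq ipos ki) andbT -[X in (_ <= X)%N]tot.
exact: leq_addr.
Qed.

(** Exchanging u and w alters one quotient q into q', with w - u = k(q' - q). The other quotients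
    determine the residue of the missing one modulo m, by [one_more_mod], so q and q' are congruent
    modulo m. *)
Lemma exchange_congr b Bs r u w : decomposition (b :: Bs) r -> u \in b -> w \in r ->
  congr_to k u w -> congr_to (k * m) u w.
Proof.
move=> D ub wr uw; have [pe sB aB] := D; have /= /andP[/andP[/eqP sb Zb] aBs] := aB.
have pb := perm_to_rem ub; have pr := perm_to_rem wr.
move: (rem u b) (rem w r) pb pr => b' r' pb pr.
have Eb : \sum_(z <- b) z = u + \sum_(z <- b') z by rewrite (perm_big _ pb) big_cons.
have Zb' : (k %| w + \sum_(z <- b') z)%Z.
  have -> : w + \sum_(z <- b') z = (w - u) + \sum_(z <- b) z by rewrite Eb; ring.
  exact: rpredD.
have D' : decomposition ((w :: b') :: Bs) (u :: r').
  split=> //; last by rewrite /= aBs /is_block big_cons Zb' -sb (perm_size pb) /= eqxx.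
  move/seq.permP: pe => pe; move/seq.permP: pb => pb; move/seq.permP: pr => pr.
  by apply/seq.permP => P; move: (pe P) (pb P) (pr P); count_lia.
have nbq := quotients_no_block D; have nbq' := quotients_no_block D'.
rewrite /= in nbq nbq'; rewrite big_cons in nbq'.
move: (divzK Zb) (divzK Zb') nbq nbq'; set q := divz _ _; set q' := divz _ _.
set Q := map _ _ => Eq Eq' nbq nbq'.
have Ewu : w - u = k%:Z * (q' - q) by rewrite mulrBr ![k%:Z * _]mulrC Eq Eq' Eb; ring.
rewrite /congr_to Ewu PoszM; apply: dvdz_mul => //.
have szQ : size (q :: Q) = (2 * (m - 1))%N by rewrite /= size_map -sB.
have [X [Y [cop cX cY]]] := im szQ nbq.
have dis v : congr_to m X v -> congr_to m Y v -> False by apply: congr_to_dis.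
have qXY : congr_to m X q || congr_to m Y q.
  by apply: all_of_count2 dis _ _ (mem_head q Q); rewrite cX cY szQ mul2n addnn.
rewrite /= in cX cY; rewrite -/(congr_to m q q').
case/orP: qXY => [Xq|Yq].
  have nYq : congr_to m Y q = false by apply/negP => /(dis q Xq).
  rewrite Xq nYq in cX cY; apply: congr_to_trans (_ : congr_to m X q').
    by rewrite congr_toC.
  by apply: (one_more_mod _ cop _ _ nbq'); move: m1 cX cY; clear; lia.
have nXq : congr_to m X q = false by apply/negP => Xq; apply: (dis q Xq Yq).
rewrite Yq nXq in cX cY; apply: congr_to_trans (_ : congr_to m Y q').
  by rewrite congr_toC.
have cop' : coprimez (X - Y) m by rewrite -opprB /coprimez gcdNz.
by apply: (one_more_mod _ cop' _ _ nbq'); move: m1 cX cY; clear; lia.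
Qed.

Lemma decomposition_exists : exists Bs r, decomposition Bs r.
Proof.
have [||Bs [r [pe sB aB]]] := @extract_blocks k (2 * (m - 1)) s _ ek; first by exact: ltnW.
  rewrite sz; have -> : (k * (2 * (m - 1)) = 2 * (k * m) - 2 * k)%N.
    by rewrite mulnCA mulnBr muln1 mulnBr.
  by have := leq_pmulr k (ltnW m1); move: (k * m)%N k1 => M; clear; lia.
by exists Bs, r.
Qed.

Lemma decomposition_head Bs r b : decomposition Bs r -> b \in Bs ->
  decomposition (b :: rem b Bs) r.
Proof. by move=> D bB; apply: decomposition_perm D; rewrite // perm_to_rem. Qed.

(* Otherwise all the block sums agree modulo k m, but the quotients take two
   values modulo m. *)
Lemma exists_constant_block Bs r x y w : decomposition Bs r -> w \in r -> congr_to k y w ->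
  (forall b, b \in Bs -> all (congr_to k x) b \/ all (congr_to k y) b) ->
  has (all (congr_to k x)) Bs.
Proof.
move=> D wr yw xy; apply/negPn/negP => /hasPn nx.
have [pe sB aB] := D.
have szQ : size [seq divz (\sum_(z <- b) z) k | b <- Bs] = (2 * (m - 1))%N by rewrite size_map.
have [X [Y [cop cX cY]]] := im szQ (quotients_no_block D).
have qw b : b \in Bs -> congr_to m w (divz (\sum_(z <- b) z) k).
  move=> bB; have D' := decomposition_head D bB.
  have yb : all (congr_to k y) b by case: (xy b bB) => // xb; have := nx b bB; rewrite xb.
  have wb : all (congr_to (k * m) w) b.
    apply/allP => u ub; rewrite congr_toC; apply: (exchange_congr D' ub wr).
    by apply: congr_to_trans yw; rewrite congr_toC; apply: (allP yb).
  have /andP[/eqP sb Zb] := allP aB b bB.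
  have := sum_congr_to wb; rewrite sb -{1}(divzK Zb) /congr_to [_ * k%:Z]mulrC -mulrBr PoszM.
  by rewrite dvdz_mul2l //; move: k1; clear; case: (k).
have wXY V : count (congr_to m V) [seq divz (\sum_(z <- b) z) k | b <- Bs] = (m - 1)%N ->
    congr_to m V w.
  move=> cV; have : has (congr_to m V) [seq divz (\sum_(z <- b) z) k | b <- Bs].
    by rewrite has_count cV subn_gt0.
  case/hasP => _ /mapP[b bB ->] Vb; apply: congr_to_trans Vb _.
  by rewrite congr_toC; apply: qw.
by apply: (congr_to_dis m1 cop (wXY _ cX) (wXY _ cY)).
Qed.

(** Exchanges compare an element of a block with one of the rest. Two elements of the rest are
    compared through an element of a constant block of the same residue, whence the need for such a
    block. *)
Lemma lift_residue Bs r x y w : decomposition Bs r -> w \in r -> congr_to k x w ->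
  coprimez (y - x) k ->
  (forall b, b \in Bs -> all (congr_to k x) b \/ all (congr_to k y) b) ->
  has (all (congr_to k x)) Bs ->
  forall z, z \in s -> congr_to k x z -> congr_to (k * m) w z.
Proof.
move=> D wr xw cop xy /hasP[b bB xb] z; have [pe sB aB] := D.
have cong u v : congr_to k x u -> congr_to k x v -> congr_to k u v.
  by rewrite (congr_toC k x u); apply: congr_to_trans.
rewrite (perm_mem pe) mem_cat => /orP[/flattenP[b' b'B zb']|zr] xz.
  rewrite congr_toC; apply: (exchange_congr (decomposition_head D b'B) zb' wr).
  exact: cong.
have /andP[/eqP sb _] := allP aB b bB.
have [u ub] : exists u, u \in b.
  by case: (b) sb => [|u b'] //= sb; [move: k1; rewrite -sb | exists u; rewrite inE eqxx].
have xu := allP xb u ub; have D' := decomposition_head D bB.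
apply: (@congr_to_trans _ _ u); last by apply: (exchange_congr D' ub zr); apply: cong.
by rewrite congr_toC; apply: (exchange_congr D' ub wr); apply: cong.
Qed.

Lemma egz_inverse_composite : exists x y, [/\ coprimez (y - x) (k * m)%N,
  count (congr_to (k * m) x) s = (k * m - 1)%N & count (congr_to (k * m) y) s = (k * m - 1)%N].
Proof.
have [Bs [r D]] := decomposition_exists; have [x [y [cop cx cy]]] := rest_two_valued D.
have cop' : coprimez (x - y) k by rewrite -opprB /coprimez gcdNz.
have km1 : (1 < k * m)%N by apply: leq_trans m1 _; rewrite leq_pmull // ltnW.
have xyB b : b \in Bs -> all (congr_to k x) b \/ all (congr_to k y) b.
  by move=> bB; apply: constant_block (decomposition_head D bB) cop cx cy.
have yxB b : b \in Bs -> all (congr_to k y) b \/ all (congr_to k x) b.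
  by move=> /xyB[]; [right|left].
have [u ur xu] : exists2 u, u \in r & congr_to k x u.
  by apply/hasP; rewrite has_count cx subn_gt0.
have [v vr yv] : exists2 v, v \in r & congr_to k y v.
  by apply/hasP; rewrite has_count cy subn_gt0.
have Lx := lift_residue D ur xu cop xyB (exists_constant_block D vr yv xyB).
have Ly := lift_residue D vr yv cop' yxB (exists_constant_block D ur xu yxB).
have dis w : congr_to (k * m) u w -> congr_to (k * m) v w -> False.
  move=> /(congr_to_dvd (dvdn_mulr m (dvdnn k))) uw /(congr_to_dvd (dvdn_mulr m (dvdnn k))) vw.
  by apply: (congr_to_dis k1 cop (congr_to_trans xu uw) (congr_to_trans yv vw)).
have szr := decomposition_size D.
have tot : (count (congr_to (k * m) u) s + count (congr_to (k * m) v) s = 2 * (k * m - 1))%N.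
  rewrite -sz -count_predUI (eq_count (a2 := pred0) (a1 := predI _ _)); last first.
    by move=> w; apply/negP => /andP[uw vw]; apply: (dis w).
  rewrite count_pred0 addn0; apply/eqP; rewrite -all_count; apply/allP => z zs /=.
  suff /orP[/(Lx z zs)->|/(Ly z zs)->] // : congr_to k x z || congr_to k y z
    by rewrite ?orbT.
  have [pe _ _] := D; move: zs; rewrite (perm_mem pe) mem_cat => /orP[/flattenP[b bB zb]|zr].
    by case: (xyB b bB) => /allP/(_ z zb) ->; rewrite ?orbT.
  apply: all_of_count2 zr; first by move=> w; apply: congr_to_dis.
  by rewrite cx cy szr mul2n addnn.
have le w : (count (congr_to (k * m) w) s <= k * m - 1)%N.
  rewrite leqNgt; apply/negP => lt.
  have [|t [q [pt at_ st]]] := @count_extract _ (congr_to (k * m) w) (k * m) s.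
    by apply: leq_trans lt; move: km1; clear; lia.
  apply: nb; exists t, q; split=> //.
  have := sum_congr_to at_; rewrite st /divides => h.
  rewrite -[X in (_ %| X)%Z](subrK ((k * m)%N%:Z * w)).
  by apply: rpredD h _; apply: dvdz_mulr.
have [cu cv] : count (congr_to (k * m) u) s = (k * m - 1)%N /\
   count (congr_to (k * m) v) s = (k * m - 1)%N.
  by move: (le u) (le v) tot; clear; lia.
exists u, v; split=> //; rewrite /coprimez eq_sym; apply/negPn/negP => nd.
have := dvdz_gcdr (v - u) (k * m)%N; have := dvdz_gcdl (v - u) (k * m)%N.
have : 0 <= gcdz (v - u) (k * m)%N by [].
case: (gcdz _ _) nd => // d nd _ /dvdzP[e Ee] /dvdzP[[j|j] Ej]; last first.
  by move: Ej km1; rewrite NegzE mulNr -PoszM; move: (k * m)%N (j.+1 * d)%N => M N; clear; lia.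
have {}Ej : (k * m = j * d)%N by move: Ej; rewrite -PoszM => -[].
(* If d > 1 is the gcd and km = jd, then j terms congruent to v and km - j terms congruent to u have
   sum congruent to j(v - u), a multiple of jd = km. Both counts are at most km - 1 since d is at
   least 2. *)
have [|||X [Y [q [pq aX aY sX sY]]]] :=
  @count_extract2 _ (congr_to (k * m) u) (congr_to (k * m) v) (k * m - j) j s.
- by [].
- by rewrite cu; move: km1; rewrite Ej; case: (j) => [|j'] //; clear; lia.
- rewrite cv; case: d nd Ej {Ee} => [|[|d]] // _ Ej.
    by move: km1; rewrite Ej muln0.
  have : (j + j <= k * m)%N by rewrite Ej mulnS mulnS addnA leq_addr.
  by move: km1; clear; lia.
apply: nb; exists (X ++ Y), q; split; first by rewrite -catA.
  by rewrite size_cat sX sY subnK // Ej leq_pmulr //; case: (d) Ej km1 => // ->; rewrite muln0.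
have := sum_congr_to aX; have := sum_congr_to aY; rewrite sX sY big_cat /divides /=.
set S1 := bigop _ _ _; set S2 := bigop _ _ _ => h1 h2.
have jkm : (j <= k * m)%N.
  by rewrite Ej leq_pmulr //; case: (d) Ej km1 => // ->; rewrite muln0.
have -> : S2 + S1 = (S2 - (k * m - j)%:Z * u) + (S1 - j%:Z * v) + (j%:Z * (v - u) + (k * m)%N%:Z * u).
  rewrite -subzn //; ring.
apply: rpredD; first exact: rpredD.
apply: rpredD; last exact: dvdz_mulr.
by rewrite Ee mulrCA -PoszM -Ej; apply: dvdz_mull.
Qed.
End Composite.

Lemma has_block_map (V W : nmodType) (f : V -> W) (Z : pred V) (Z' : pred W) n (s : seq V) :
  (forall t : seq V, Z' (\sum_(x <- [seq f v | v <- t]) x) -> Z (\sum_(x <- t) x)) ->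
  has_block Z' n [seq f v | v <- s] -> has_block Z n s.
Proof.
move=> ZZ' [t [r [pt st Zt]]]; have [u pu Eu] := perm_map_lift pt.
exists (take n u), (drop n u); split; first by rewrite cat_take_drop.
  by rewrite -(size_map f) map_take -Eu take_size_cat.
by apply: ZZ'; rewrite map_take -Eu take_size_cat.
Qed.

Lemma egz_inverse_prime p : prime p -> egz_inverse p.
Proof.
move=> p_pr s sz nb; have p1 := prime_gt1 p_pr.
have card_F : #|'F_p| = p by rewrite card_Fp.
have mulrn_p (d : 'F_p) : d *+ p = 0 by rewrite -mulr_natr pchar_Fp_0 // mulr0.
have mulrn_F (d x : 'F_p) : d != 0 -> exists2 m, (m < p)%N & x = d *+ m.
  move=> d0; exists (val (x / d)); last by rewrite -mulr_natr natr_Zp mulrC divfK.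
  by have := ltn_ord (x / d); rewrite [X in (_ < X)%N]Fp_cast.
pose f (z : int) : 'F_p := z%:~R.
have dvdf z : (p %| z)%Z = (f z == 0) by rewrite (dvdz_pcharf (pchar_Fp p_pr)).
have [||x [y [nxy cx cy]]] := egz_inverse_prime_order p1 card_F mulrn_p mulrn_F (s := map f s).
- by rewrite size_map.
- move=> bl; apply: nb; apply: has_block_map bl => t /=.
  by rewrite /divides dvdf big_map /f rmorph_sum.
have lift (v : 'F_p) : f (val v)%:Z = v by rewrite /f -pmulrn natr_Zp.
have congrE (v : 'F_p) z : congr_to p (val v)%:Z z = (f z == v).
  have fB : f (z - (val v)%:Z) = f z - f (val v)%:Z by rewrite /f rmorphB.
  by rewrite /congr_to dvdf fB lift subr_eq0.
exists (val x)%:Z, (val y)%:Z; split.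
- rewrite coprimez_sym coprimezE prime_coprime //; apply: contra nxy => xy.
  have : congr_to p (val x)%:Z (val y)%:Z by [].
  by rewrite congrE lift eq_sym.
- by rewrite -cx count_map; apply: eq_count => z /=; rewrite congrE.
- by rewrite -cy count_map; apply: eq_count => z /=; rewrite congrE.
Qed.

Lemma egz_inverse_all n : (0 < n)%N -> egz_inverse n.
Proof.
elim/ltn_ind: n => n IH n0.
have [n1|n1] := leqP n 1.
  have -> : n = 1%N by lia.
  by move=> s /size0nil -> _; exists 0, 0; split=> //; rewrite coprimez_sym coprimezE.
have p_pr := pdiv_prime n1; have pn := pdiv_dvd n; set p := pdiv n in p_pr pn.
have p1 := prime_gt1 p_pr; have En := divnK pn.
have [m1|m1] := leqP (n %/ p) 1.
  have m0 : (0 < n %/ p)%N by rewrite divn_gt0 ?prime_gt0 // dvdn_leq.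
  have {m0}m1 : (n %/ p = 1)%N by lia.
  by rewrite -En m1 mul1n; apply: egz_inverse_prime.
have ltm : (n %/ p < n)%N by rewrite ltn_Pdiv.
have im := IH _ ltm (ltnW m1); have ip := egz_inverse_prime p_pr.
have em := egz_of_inverse (ltnW m1) im; have ep := egz_of_inverse (ltnW p1) ip.
rewrite -En mulnC => s sz nb.
exact: (egz_inverse_composite p1 m1 ep em ip im sz nb).
Qed.

(** * The inverse theorem in the subgroup of multiples of e *)

Section CyclicSubgroup.
Variables (G : zmodType) (e : G) (n : nat).
Hypothesis n0 : (0 < n)%N.
Hypothesis e_order : forall z : int, (e *~ z == 0) = (n %| z)%Z.

Definition multiple (x : G) := exists z : int, x = e *~ z.

(** The explicit coefficient below n serves later as a number of terms to select, and as the
    parameter a or b of the families. *)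
Definition generates (d : G) :=
  (forall q, multiple q -> exists2 j, (j < n)%N & q = d *+ j) /\
  (forall j, d *+ j = 0 -> (n %| j)%N).

Lemma multiple_lift (U : seq G) : {in U, forall x, multiple x} ->
  exists zs : seq int, U = [seq e *~ z | z <- zs].
Proof.
elim: U => [|x U IH] mU; first by exists [::].
have [z ->] := mU x (mem_head _ _).
have [y yU|zs ->] := IH; first by apply: mU; rewrite inE yU orbT.
by exists (z :: zs).
Qed.

Lemma multiple_has_block (zs : seq int) :
  has_block (divides n) n zs -> has_block (pred1 0) n [seq e *~ z | z <- zs].
Proof.
move=> [t [r [pt st Zt]]]; exists [seq e *~ z | z <- t], [seq e *~ z | z <- r].
rewrite -map_cat perm_map // size_map; split=> //=.
by rewrite big_map -mulrz_sumr e_order.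
Qed.

Lemma multiple_egz (U : seq G) : {in U, forall x, multiple x} ->
  size U = (2 * n - 1)%N -> has_block (pred1 0) n U.
Proof.
move=> /multiple_lift[zs ->]; rewrite size_map => sz.
by apply: multiple_has_block; apply: egz_of_inverse sz => //; apply: egz_inverse_all.
Qed.

Lemma multiple_egz_inverse (U : seq G) : {in U, forall x, multiple x} ->
  size U = (2 * (n - 1))%N -> ~ has_block (pred1 0) n U ->
  exists x y, [/\ multiple x, multiple y, generates (x - y),
     count_mem x U = (n - 1)%N & count_mem y U = (n - 1)%N].
Proof.
move=> /multiple_lift[zs ->]; rewrite size_map => sz nb.
have [||y [x [cop cy cx]]] := egz_inverse_all n0 (s := zs) => //.
  by move/multiple_has_block.
have cE (v : int) : count_mem (e *~ v) [seq e *~ z | z <- zs] = count (congr_to n v) zs.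
  rewrite count_map; apply: eq_count => z /=.
  by rewrite -subr_eq0 -mulrzBr e_order.
exists (e *~ x), (e *~ y); split; rewrite ?cE //; [by exists x | by exists y |].
rewrite -mulrzBr; split=> [_ [z ->]|j E].
  have [j ltj D] := solve_linear_mod z n0 cop; exists j => //.
  rewrite pmulrn -mulrzA; apply/eqP; rewrite -subr_eq0 -mulrzBr e_order.
  by rewrite mulrC.
have : (n %| (x - y) * j)%Z by rewrite -e_order mulrzA -pmulrn E.
by rewrite Gauss_dvdzr // coprimez_sym.
Qed.
End CyclicSubgroup.

(** * Pairing elements with equal class modulo 2G *)

Local Notation classes3 := ('Z_2 * 'Z_2 * 'Z_2)%type.

Lemma addTT (t : classes3) : t + t = 0.
Proof.
have Z2 (i : 'Z_2) : i + i = 0 by case: i => [[|[|]]] // i; apply: val_inj.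
by case: t => [[i j] k]; congr (_, _, _); apply: Z2.
Qed.

(** For independent v, u, w, all eight elements of the group, listed as four consecutive couples of
    difference v. *)
Definition frame (v u w : classes3) : seq classes3 :=
  [:: 0; v; u; u + v; w; w + v; u + w; u + w + v].

Lemma uniq_all_T (s : seq classes3) t : uniq s -> size s = 8%N -> t \in s.
Proof.
move=> us sz; have : #|{: classes3}| = 8%N by rewrite !card_prod !card_ord.
move=> cT; have : [set x in s] == [set: classes3].
  rewrite eqEcard subsetT cardsT cT -sz -(card_uniqP us) cardsE; exact: leqnn.
by move/eqP/setP/(_ t); rewrite !inE => ->.
Qed.

Lemma frame_exists (v : classes3) : v != 0 -> exists u w, uniq (frame v u w).
Proof.
case: v => [[i j] k] v0.
pose u : classes3 := if i == 0 then (1, 0, 0) else (0, 1, 0).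
pose w : classes3 := if (i == 0) && (j == 0) then (0, 1, 0) else (0, 0, 1).
exists u, w; rewrite {}/u {}/w; move: i j k v0.
by do 3!case=> [[|[|]]] //= ?.
Qed.

Lemma frame_perm (v u w c : classes3) : uniq (frame v u w) -> uniq [seq c + t | t <- frame v u w].
Proof. by move=> uf; rewrite map_inj_uniq //; apply: addrI. Qed.

Lemma eq_add0 (t s : classes3) : t = s + s -> t = 0.
Proof. by move=> ->; apply: addTT. Qed.

Lemma uniq_map_inj (U V : eqType) (f : U -> V) (s : seq U) :
  uniq [seq f x | x <- s] -> {in s &, injective f}.
Proof.
elim: s => //= x s IH /andP[nx us] y z; rewrite !inE.
case/predU1P=> [->|ys] /predU1P[->|zs] // E; last exact: IH.
- by move: nx; rewrite E map_f.
- by move: nx; rewrite -E map_f.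
Qed.

Section Pairs.
Variables (G : zmodType) (e : G) (n : nat).
Hypotheses (n1 : (1 < n)%N) (e_order : forall z : int, (e *~ z == 0) = (n %| z)%Z).
Variable cls : {additive G -> classes3}.
Hypothesis cls_ker : forall g, cls g = 0 -> multiple e g.
Variables (A : comNzRingType) (phi : {additive G -> A}).
Hypothesis phi_inj : injective phi.

(** The injection [phi] into a commutative ring carries identities between elements of G to a place
    where [ring] decides them. *)
Ltac group_ring :=
  apply: phi_inj; rewrite ?(raddfMn phi, raddfMz phi, raddf0 phi, raddfD phi, raddfN phi); ring.

Definition pair_sums (ps : seq (G * G)) := [seq q.1 + q.2 | q <- ps].

Definition congruent_pairs (ps : seq (G * G)) := all (fun q => cls q.1 == cls q.2) ps.

Lemma pair_sums_multiple ps : congruent_pairs ps ->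
  {in pair_sums ps, forall x, multiple e x}.
Proof.
move=> cp _ /mapP[q qin ->]; apply: cls_ker.
by rewrite raddfD (eqP (allP cp q qin)) addTT.
Qed.

Lemma multipleD x y : multiple e x -> multiple e y -> multiple e (x + y).
Proof. by move=> [a ->] [b ->]; exists (a + b); rewrite mulrzDr. Qed.

Lemma multipleN x : multiple e x -> multiple e (- x).
Proof. by move=> [a ->]; exists (- a); rewrite mulrNz. Qed.

Lemma multiple_sum (s : seq G) : {in s, forall x, multiple e x} ->
  multiple e (\sum_(x <- s) x).
Proof.
elim: s => [|x s IH] h; first by exists 0; rewrite big_nil mulr0z.
rewrite big_cons; apply: multipleD; first exact: h (mem_head _ _).
by apply: IH => y ys; apply: h; rewrite inE ys orbT.
Qed.

Variable S : seq G.
Hypothesis nb : ~ has_block (pred1 0) (2 * n) S.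

(** The elements of m pairs, together with Q, have length 2n; so no m pair sums add up to the
    opposite of the sum of Q. *)
Lemma pairs_no_block ps Q R m : perm_eq S (unpair ps ++ Q ++ R) ->
  (2 * m + size Q = 2 * n)%N -> ~ has_block (pred1 (- \sum_(x <- Q) x)) m (pair_sums ps).
Proof.
move=> pe sz [t [r [pt st /eqP Zt]]]; apply: nb.
have [ps' pp E] := perm_map_lift pt.
have Et : t = pair_sums (take m ps').
  by rewrite /pair_sums map_take -E take_size_cat.
have szm : size (take m ps') = m by rewrite -[RHS]st Et size_map.
exists (unpair (take m ps') ++ Q), (unpair (drop m ps') ++ R); split.
- have := perm_unpair pp; rewrite -{1}[ps'](cat_take_drop m) unpair_cat => pu.
  apply/seq.permP => P; move: (seq.permP pe P) (seq.permP pu P).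
  count_lia.
- by rewrite size_cat size_unpair szm.
have Eu : \sum_(x <- unpair (take m ps')) x = \sum_(x <- t) x.
  by rewrite Et /pair_sums big_map sum_unpair.
by rewrite big_cat /= Eu Zt addNr.
Qed.

Lemma few_pairs ps R : congruent_pairs ps -> perm_eq S (unpair ps ++ R) ->
  (size ps < 2 * n - 1)%N.
Proof.
move=> cp pe; rewrite ltnNge; apply/negP => le.
have pe' : perm_eq S (unpair (take (2 * n - 1) ps) ++ [::] ++ (unpair (drop (2 * n - 1) ps) ++ R)).
  by rewrite cat0s catA -unpair_cat cat_take_drop.
apply: (pairs_no_block pe' (m := n)); first by rewrite addn0.
rewrite big_nil oppr0; apply: (multiple_egz (ltnW n1) e_order).
  apply: pair_sums_multiple; apply/allP => q /mem_take; exact: (allP cp).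
by rewrite size_map size_takel.
Qed.

Lemma pair_sums_two_valued ps R : congruent_pairs ps -> perm_eq S (unpair ps ++ R) ->
  size ps = (2 * (n - 1))%N ->
  exists x y, [/\ multiple e x, multiple e y, generates e n (x - y),
     count_mem x (pair_sums ps) = (n - 1)%N & count_mem y (pair_sums ps) = (n - 1)%N].
Proof.
move=> cp pe sp; apply: (multiple_egz_inverse (ltnW n1) e_order).
- exact: pair_sums_multiple.
- by rewrite size_map.
have := @pairs_no_block ps [::] R n pe; rewrite big_nil oppr0; apply.
by rewrite addn0.
Qed.

Lemma generates_neq x y : generates e n (x - y) -> x != y.
Proof.
move=> [_ /(_ 1%N)]; rewrite mulr1n; case: eqP => // -> h.
by have := h (subrr _); rewrite dvdn1; move: n1; clear; case: (n) => [|[|]].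
Qed.

Lemma multiple_mulrn x : multiple e x -> x *+ n = 0.
Proof.
move=> [z ->]; apply/eqP; rewrite pmulrn -mulrzA e_order.
exact: dvdz_mull.
Qed.

(* A quadruple of classes summing to 0, completed by n - 2 pairs, has length
   2n; among the sums of n - 2 pairs only the opposite of x + y is missed. *)
Lemma quadruple_sum ps a b c d R x y : perm_eq S (unpair ps ++ [:: a; b; c; d] ++ R) ->
  cls (a + b + c + d) = 0 -> multiple e x -> multiple e y -> generates e n (x - y) ->
  (n - 2 <= count_mem x (pair_sums ps))%N -> (n - 2 <= count_mem y (pair_sums ps))%N ->
  a + b + c + d = x + y.
Proof.
move=> pe c0 mx my g cx cy.
have nxy := generates_neq g.
have [|[|j] ltj E] := g.1 (a + b + c + d - (x + y)).
- apply: multipleD (cls_ker c0) _; apply: multipleN; exact: multipleD.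
- by apply/eqP; rewrite -subr_eq0 E mulr0n.
case: (@pairs_no_block ps [:: a; b; c; d] R (n - 2) pe).
  by move: n1; clear => /=; lia.
(* The quadruple has sum x + y + (j+1)(x - y); adding n - j - 2 copies of x and j copies of y gives
   n x = 0. *)
have [|||t1 [t2 [r [pq /all_pred1P a1 /all_pred1P a2 s1 s2]]]] :=
  @count_extract2 _ (pred1 x) (pred1 y) (n - j.+2) j (pair_sums ps).
- by move=> z /= /eqP -> /eqP; apply/eqP.
- by apply: leq_trans cx; move: ltj; clear; lia.
- by apply: leq_trans cy; move: ltj; clear; lia.
exists (t1 ++ t2), r; split; first by rewrite -catA.
  by rewrite size_cat s1 s2; move: ltj; clear; lia.
rewrite /= big_cat /= a1 a2 !big_nseq s1 s2 !iter_addr_0 !big_cons big_nil addr0.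
have -> : x *+ (n - j.+2) = - (x *+ j.+2).
  by apply/eqP; rewrite -subr_eq0 opprK -mulrnDr subnK ?(multiple_mulrn mx).
have -> : a + (b + (c + d)) = (x + y) + (x - y) *+ j.+1 by rewrite -E; group_ring.
apply/eqP; group_ring.
Qed.

Lemma two_values (U : seq G) x y m : x != y -> count_mem x U = m -> count_mem y U = m ->
  size U = (2 * m)%N -> forall z, z \in U -> z = x \/ z = y.
Proof.
move=> nxy cx cy sz z zU.
have : pred1 x z || pred1 y z.
  apply: (all_of_count2 _ _ zU); last by rewrite cx cy sz mul2n addnn.
  by move=> t /= /eqP -> /eqP; apply/eqP.
by case/orP => /eqP ->; [left|right].
Qed.

(* Appending to the pair sums the one element v for which a block through v
   would complete the quadruple makes the inverse theorem applicable. *)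
Lemma quadruple_pairs ps a b c d R : congruent_pairs ps ->
  perm_eq S (unpair ps ++ [:: a; b; c; d] ++ R) -> size ps = (2 * n - 3)%N ->
  cls (a + b + c + d) = 0 -> exists x y, [/\ multiple e x, multiple e y, generates e n (x - y) &
   [/\ (n - 2 <= count_mem x (pair_sums ps))%N, (n - 2 <= count_mem y (pair_sums ps))%N &
       forall z, z \in pair_sums ps -> z = x \/ z = y]].
Proof.
move=> cp pe sp c0; set U := pair_sums ps; set q := a + b + c + d in c0.
have mU := pair_sums_multiple cp; have szU : size U = (2 * n - 3)%N by rewrite size_map.
(* If n terms including v add up to 0, the complementary n - 2 pair sums add up to -q, so the
   corresponding pairs and the quadruple form a zero-sum subsequence of length 2n. *)
pose v := - (\sum_(z <- U) z + q).
have nv : ~ has_block (pred1 0) n (v :: U).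
  case=> t [r [pt st /eqP Zt]]; have [vt|vt] := boolP (v \in t).
    have pt' := perm_to_rem vt; move: (rem v t) pt' => t' pt'.
    have pU : perm_eq U (r ++ t').
      by apply/seq.permP => P; move: (seq.permP pt P) (seq.permP pt' P); count_lia.
    apply: (@pairs_no_block ps [:: a; b; c; d] R (n - 2) pe).
      by move: n1; clear => /=; lia.
    exists r, t'; split=> //.
      have := perm_size pt; have := perm_size pt'; rewrite size_cat /= st szU.
      by move: (size r) (size t') n1; clear => i j; lia.
    move: Zt; rewrite (perm_big _ pt') big_cons /v (perm_big _ pU) big_cat /= => Zt.
    have Zr : \sum_(z <- r) z + q
        = - (- (\sum_(z <- r) z + \sum_(z <- t') z + q) + \sum_(z <- t') z) by group_ring.
    rewrite Zt oppr0 in Zr; apply/eqP; apply: (addIr q); rewrite Zr !big_cons big_nil addr0.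
    have -> : a + (b + (c + d)) = q by rewrite /q !addrA.
    by rewrite addNr.
  have vr : v \in r by have := perm_mem pt v; rewrite mem_cat inE eqxx (negbTE vt).
  have := @pairs_no_block ps [::] ([:: a; b; c; d] ++ R) n pe; rewrite big_nil oppr0.
  apply; first by rewrite addn0.
  exists t, (rem v r); split=> //; last exact/eqP.
  rewrite -(perm_cons v) (permPl pt) perm_sym -cat1s perm_catCA perm_cat2l cat1s perm_sym.
  exact: perm_to_rem.
have mv : multiple e v.
  by apply: multipleN; apply: multipleD; [exact: multiple_sum | exact: cls_ker].
have mvU : {in v :: U, forall x, multiple e x}.
  by move=> z; rewrite inE => /predU1P[->|/mU].
have szv : size (v :: U) = (2 * (n - 1))%N by rewrite /= szU; move: n1; clear; lia.
have [x [y [mx my g cx cy]]] := multiple_egz_inverse (ltnW n1) e_order mvU szv nv.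
have tv := two_values (generates_neq g) cx cy szv.
exists x, y; split=> //; split.
- by move: cx => /=; case: (v == x); move: (count _ _) n1; clear => i; lia.
- by move: cy => /=; case: (v == y); move: (count _ _) n1; clear => i; lia.
by move=> z zU; apply: tv; rewrite inE zU orbT.
Qed.

(** * Eight remaining elements *)

Lemma double_eq (g0 g1 a b b' c d q : G) : g0 + a + b + c = q -> g1 + a + b + d = q ->
  g0 + a + b' + d = q -> g1 + a + b' + c = q -> g0 + g0 = g1 + g1.
Proof.
move=> h1 h2 h3 h4; apply/eqP; rewrite -subr_eq0; apply/eqP.
have -> : g0 + g0 - (g1 + g1) = (g0 + a + b + c) - (g1 + a + b + d)
   + (g0 + a + b' + d) - (g1 + a + b' + c) by group_ring.
by rewrite h1 h2 h3 h4 subrr add0r subrr.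
Qed.

(** Four distinct classes add up to 0 exactly when they form an affine plane over Z_2. Each of the
    eight planes chosen here gives a quadruple of sum x + y. *)
Lemma eight_sums ps g0 g1 g2 g3 g4 g5 g6 g7 c v u w : congruent_pairs ps ->
  perm_eq S (unpair ps ++ [:: g0; g1; g2; g3; g4; g5; g6; g7]) -> size ps = (2 * n - 3)%N ->
  [seq cls g | g <- [:: g0; g1; g2; g3; g4; g5; g6; g7]] = [seq c + t | t <- frame v u w] ->
  [/\ g0 + g0 = g1 + g1, g0 + g1 + g2 + g3 = g4 + g5 + g6 + g7 &
      exists x y, [/\ generates e n (x - y), forall z, z \in pair_sums ps -> z = x \/ z = y
                     & g0 + g0 + (g0 + g0) = x + y]].
Proof.
move=> cp pe sp; case; rewrite addr0 => E0 E1 E2 E3 E4 E5 E6 E7.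
have c0 : cls (g0 + g1 + g2 + g3) = 0.
  by rewrite !raddfD E0 E1 E2 E3; apply: (@eq_add0 _ (c + c + u + v)); ring.
have [x [y [mx my g [cx cy xy]]]] := @quadruple_pairs ps g0 g1 g2 g3 [:: g4; g5; g6; g7] cp pe sp c0.
have Q a b c' d R : cls (a + b + c' + d) = 0 ->
    perm_eq [:: g0; g1; g2; g3; g4; g5; g6; g7] ([:: a; b; c'; d] ++ R) ->
    a + b + c' + d = x + y.
  move=> k0 pr; apply: (@quadruple_sum ps a b c' d R x y _ k0 mx my g cx cy).
  by rewrite (permPl pe) perm_cat2l.
have Q0123 : g0 + g1 + g2 + g3 = x + y by apply: (@Q _ _ _ _ [:: g4; g5; g6; g7]).
have Q4567 : g4 + g5 + g6 + g7 = x + y.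
  apply: (@Q _ _ _ _ [:: g0; g1; g2; g3]); last by apply/seq.permP => P; count_lia.
  by rewrite !raddfD E4 E5 E6 E7; apply: (@eq_add0 _ (c + c + u + v + w + w)); ring.
have Q0145 : g0 + g1 + g4 + g5 = x + y.
  apply: (@Q _ _ _ _ [:: g2; g3; g6; g7]); last by apply/seq.permP => P; count_lia.
  by rewrite !raddfD E0 E1 E4 E5; apply: (@eq_add0 _ (c + c + v + w)); ring.
have Q0167 : g0 + g1 + g6 + g7 = x + y.
  apply: (@Q _ _ _ _ [:: g2; g3; g4; g5]); last by apply/seq.permP => P; count_lia.
  by rewrite !raddfD E0 E1 E6 E7; apply: (@eq_add0 _ (c + c + v + w + u)); ring.
have Q0246 : g0 + g2 + g4 + g6 = x + y.
  apply: (@Q _ _ _ _ [:: g1; g3; g5; g7]); last by apply/seq.permP => P; count_lia.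
  by rewrite !raddfD E0 E2 E4 E6; apply: (@eq_add0 _ (c + c + w + u)); ring.
have Q1247 : g1 + g2 + g4 + g7 = x + y.
  apply: (@Q _ _ _ _ [:: g0; g3; g5; g6]); last by apply/seq.permP => P; count_lia.
  by rewrite !raddfD E1 E2 E4 E7; apply: (@eq_add0 _ (c + c + w + u + v)); ring.
have Q0257 : g0 + g2 + g5 + g7 = x + y.
  apply: (@Q _ _ _ _ [:: g1; g3; g4; g6]); last by apply/seq.permP => P; count_lia.
  by rewrite !raddfD E0 E2 E5 E7; apply: (@eq_add0 _ (c + c + w + u + v)); ring.
have Q1256 : g1 + g2 + g5 + g6 = x + y.
  apply: (@Q _ _ _ _ [:: g0; g3; g4; g7]); last by apply/seq.permP => P; count_lia.
  by rewrite !raddfD E1 E2 E5 E6; apply: (@eq_add0 _ (c + c + w + u + v)); ring.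
have D01 : g0 + g0 = g1 + g1 by apply: double_eq Q0246 Q1247 Q0257 Q1256.
split=> //; first by rewrite Q0123 Q4567.
(* The three planes through the line of g0 and g1 cover this line three times and every other point
   once, so their total exceeds the sum of all eight elements by 2(g0 + g1). *)
exists x, y; split=> //; rewrite {2}D01.
have -> : g0 + g0 + (g1 + g1) = (g0 + g1 + g2 + g3) + (g0 + g1 + g4 + g5) + (g0 + g1 + g6 + g7)
  - (g0 + g1 + g2 + g3) - (g4 + g5 + g6 + g7) by group_ring.
by rewrite Q0123 Q4567 Q0145 Q0167; group_ring.
Qed.

Lemma classes_perm (R : seq G) (L : seq classes3) : uniq [seq cls g | g <- R] -> uniq L ->
  [seq cls g | g <- R] =i L -> exists2 R', perm_eq R R' & [seq cls g | g <- R'] = L.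
Proof.
by move=> uR uL RL; have [R' pR ->] := perm_map_lift (uniq_perm uR uL RL); exists R'.
Qed.

Lemma frame_rest (R : seq G) c v : uniq [seq cls g | g <- R] -> size R = 8%N -> v != 0 ->
  exists u w g0 g1 g2 g3 g4 g5 g6 g7, perm_eq R [:: g0; g1; g2; g3; g4; g5; g6; g7] /\
  [seq cls g | g <- [:: g0; g1; g2; g3; g4; g5; g6; g7]] = [seq c + t | t <- frame v u w].
Proof.
move=> uR sR /frame_exists[u [w uf]]; have uf' := frame_perm c uf.
have [|R' pR E] := classes_perm uR uf'.
  by move=> t; rewrite !uniq_all_T ?size_map.
exists u, w; move: E (perm_size pR); rewrite sR.
case: R' pR => [|g0 [|g1 [|g2 [|g3 [|g4 [|g5 [|g6 [|g7 [|//]]]]]]]]] // pR E _.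
by exists g0, g1, g2, g3, g4, g5, g6, g7.
Qed.

Lemma no_eight_classes ps R : congruent_pairs ps -> perm_eq S (unpair ps ++ R) ->
  size ps = (2 * n - 3)%N -> uniq [seq cls g | g <- R] -> size R = 8%N -> False.
Proof.
move=> cp pe sp uR sR.
have [z0 z0R] : exists z, z \in R by case: (R) sR => // z R' _; exists z; apply: mem_head.
have dbl z : z \in R -> z + z = z0 + z0.
  move=> zR; have [->//|nz] := eqVneq z z0.
  have nv : cls z - cls z0 != 0.
    by rewrite subr_eq0; apply: contra nz => /eqP/(uniq_map_inj uR zR z0R)->.
  have [u [w [g0 [g1 [g2 [g3 [g4 [g5 [g6 [g7 [pR E]]]]]]]]]]] := frame_rest (cls z0) uR sR nv.
  have pe' := pe; rewrite (permPr (perm_cat (perm_refl _) pR)) in pe'.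
  have [D _ _] := eight_sums cp pe' sp E.
  have [Eg0 Eg1] : g0 = z0 /\ g1 = z.
    case: E; rewrite addr0 addrC subrK => E0 E1 _ _ _ _ _ _.
    by split; apply: (uniq_map_inj uR) => //; rewrite (perm_mem pR) !inE eqxx ?orbT.
  by rewrite -Eg0 -Eg1 D.
have nv : ((1, 0, 0) : classes3) != 0 by [].
have pairC q : q \in ps -> q.1 + q.2 = z0 + z0.
  case: q => a b /= qin; have pq := perm_to_rem qin; move: (rem _ ps) pq => ps' pq.
  have cab : cls a = cls b by apply/eqP; apply: (allP cp _ qin).
  have [u [w [g0 [g1 [g2 [g3 [g4 [g5 [g6 [g7 [pR E]]]]]]]]]]] := frame_rest (cls a) uR sR nv.
  have g0R : g0 \in R by rewrite (perm_mem pR) mem_head.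
  have Ea : cls g0 = cls a by case: E => ->; rewrite addr0.
  have pe' := pe; rewrite (permPr (perm_cat (perm_refl _) pR)) in pe'.
  have cp' : congruent_pairs ps' by move: cp; rewrite /congruent_pairs (perm_all _ pq) => /andP[].
  (* The relation g0 + g1 + g2 + g3 = g4 + g5 + g6 + g7 determines g0 from the other seven; it still
     holds when a' takes the place of g0. *)
  have swap a' b' : perm_eq [:: a; b] [:: a'; b'] -> cls a' = cls a -> cls b' = cls a ->
      g0 = a'.
    move=> pab Ea' Eb'.
    have [_ h1 _] := eight_sums cp pe' sp E.
    have [||||_ h2 _] := @eight_sums ((g0, b') :: ps') a' g1 g2 g3 g4 g5 g6 g7 (cls a) (1, 0, 0) u w.
    - by rewrite /congruent_pairs /= Ea Eb' eqxx.
    - apply/seq.permP => P; move: (seq.permP pe' P) (seq.permP (perm_unpair pq) P) (seq.permP pab P).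
      by count_lia.
    - by rewrite -sp (perm_size pq).
    - by rewrite -E /= Ea Ea'.
    by apply: (addIr (g1 + g2 + g3)); rewrite !addrA h1 h2.
  have <- : g0 = a by apply: swap (perm_refl _) _ _.
  have <- : g0 = b by apply: swap (permEl (perm_catC [:: a] [:: b])) _ _; rewrite ?cab.
  exact: dbl.
(* All pair sums being 2 z0, this value is x or y; then 4 z0 = x + y gives x = y. *)
have [u [w [g0 [g1 [g2 [g3 [g4 [g5 [g6 [g7 [pR E]]]]]]]]]]] := frame_rest (cls z0) uR sR nv.
have pe' := pe; rewrite (permPr (perm_cat (perm_refl _) pR)) in pe'.
have [_ _ [x [y [g xy D]]]] := eight_sums cp pe' sp E.
have {}D : z0 + z0 + (z0 + z0) = x + y by rewrite -D -(dbl g0) ?(perm_mem pR) ?mem_head.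
have : z0 + z0 \in pair_sums ps.
  case: (ps) sp pairC => [|q ps'] /= sp' pairC; first by move: n1 sp'; clear; lia.
  by rewrite -(pairC q) ?mem_head // inE eqxx.
have /eqP nxy := generates_neq g.
by case/xy => D'; apply: nxy; rewrite D' in D; [apply: addrI D | apply/esym; apply: addIr D].
Qed.

Lemma maximal_pairing (s : seq G) : exists ps R, [/\ congruent_pairs ps,
  perm_eq s (unpair ps ++ R) & uniq [seq cls g | g <- R]].
Proof.
elim: s => [|x s [ps [R [cp pe uR]]]]; first by exists [::], [::].
have [/mapP[z zR Ez]|nx] := boolP (cls x \in [seq cls g | g <- R]); last first.
  exists ps, (x :: R); split=> //=; last by rewrite nx.
  by apply/seq.permP => P; move: (seq.permP pe P); count_lia.
have pz := perm_to_rem zR; exists ((x, z) :: ps), (rem z R); split.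
- by rewrite /congruent_pairs /= Ez eqxx.
- by apply/seq.permP => P; move: (seq.permP pe P) (seq.permP pz P); count_lia.
by move: uR; rewrite (perm_uniq (perm_map cls pz)) /= => /andP[].
Qed.

(** * Six remaining elements *)

Definition six_config ps a1 b1 a2 b2 a3 b3 :=
  [/\ congruent_pairs ps, perm_eq S (unpair ps ++ [:: a1; b1; a2; b2; a3; b3]),
      size ps = (2 * (n - 1))%N,
      cls a1 + cls b1 = cls a2 + cls b2 & cls a2 + cls b2 = cls a3 + cls b3].

(** Any two of the three couples form a quadruple of sum x + y, so the three couple sums agree and
    their common double is x + y. *)
Lemma six_sums ps a1 b1 a2 b2 a3 b3 : six_config ps a1 b1 a2 b2 a3 b3 ->
  [/\ a1 + b1 = a2 + b2, a2 + b2 = a3 + b3 & exists x y,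
    [/\ multiple e x, multiple e y, generates e n (x - y) &
     [/\ count_mem x (pair_sums ps) = (n - 1)%N, count_mem y (pair_sums ps) = (n - 1)%N &
         a1 + b1 + (a1 + b1) = x + y]]].
Proof.
case=> cp pe sp h12 h23.
have [x [y [mx my g cx cy]]] := pair_sums_two_valued cp pe sp.
have Q a b c d R : cls a + cls b = cls c + cls d ->
    perm_eq [:: a1; b1; a2; b2; a3; b3] ([:: a; b; c; d] ++ R) -> a + b + c + d = x + y.
  move=> k pr; apply: (@quadruple_sum ps a b c d R x y _ _ mx my g).
  - by rewrite (permPl pe) perm_cat2l.
  - by rewrite !raddfD k -addrA addTT.
  - by rewrite cx leq_sub2l.
  by rewrite cy leq_sub2l.
have Q12 : a1 + b1 + a2 + b2 = x + y by apply: (@Q _ _ _ _ [:: a3; b3]).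
have Q13 : a1 + b1 + a3 + b3 = x + y.
  by apply: (@Q _ _ _ _ [:: a2; b2]); rewrite ?h12 //; apply/seq.permP => P; count_lia.
have Q23 : a2 + b2 + a3 + b3 = x + y.
  by apply: (@Q _ _ _ _ [:: a1; b1]) => //; apply/seq.permP => P; count_lia.
have E12 : a1 + b1 = a2 + b2 by apply: (addIr (a3 + b3)); rewrite !addrA Q13 Q23.
split=> //; first by apply: (addrI (a1 + b1)); rewrite !addrA Q12 Q13.
by exists x, y; split=> //; split=> //; rewrite {2}E12 addrA.
Qed.

Lemma six_flip ps a1 b1 a2 b2 a3 b3 : six_config ps a1 b1 a2 b2 a3 b3 ->
  six_config ps b1 a1 a2 b2 a3 b3.
Proof.
case=> cp pe sp h12 h23; split; rewrite 1?(addrC (cls b1)) //.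
by apply/seq.permP => P; move: (seq.permP pe P); count_lia.
Qed.

Lemma six_rot ps a1 b1 a2 b2 a3 b3 : six_config ps a1 b1 a2 b2 a3 b3 ->
  six_config ps a2 b2 a3 b3 a1 b1.
Proof.
case=> cp pe sp h12 h23; split; rewrite ?h12 //.
by apply/seq.permP => P; move: (seq.permP pe P); count_lia.
Qed.

(** The relation a1 + b1 = a2 + b2 determines a1 from the other elements, and it persists when an
    element of the pair replaces a1. *)
Lemma six_swap ps a1 b1 a2 b2 a3 b3 q : six_config ps a1 b1 a2 b2 a3 b3 ->
  q \in ps -> cls q.1 = cls a1 -> q.1 = a1 /\ q.2 = a1.
Proof.
move=> C; have [cp pe sp h12 h23] := C; have [s12 _ _] := six_sums C.
case: q => p q /= qin Ep; have pq := perm_to_rem qin; move: (rem _ ps) pq => ps' pq.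
have cpq : cls p = cls q by apply/eqP; apply: (allP cp _ qin).
have cp' : congruent_pairs ps' by move: cp; rewrite /congruent_pairs (perm_all _ pq) => /andP[].
have swap a b : perm_eq [:: p; q] [:: a; b] -> cls a = cls a1 -> cls b = cls a1 -> a = a1.
  move=> pab Ea Eb; have [|s12' _ _] := @six_sums ((a1, b) :: ps') a b1 a2 b2 a3 b3.
    split; rewrite ?Ea //; last by rewrite -sp (perm_size pq).
      by rewrite /congruent_pairs /= Eb eqxx.
    apply/seq.permP => P; move: (seq.permP pe P) (seq.permP (perm_unpair pq) P) (seq.permP pab P).
    by count_lia.
  by apply: (addIr b1); rewrite s12 s12'.
split; first by apply: swap (perm_refl _) _ _; rewrite -?cpq.
by apply: swap (permEl (perm_catC [:: p] [:: q])) _ _; rewrite -?cpq.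
Qed.

(** This treats a pair in a class that no remaining element has. An element p of it completes one
    value from each couple to a quadruple; using up this pair still leaves n - 2 copies of x and y.
    Comparison of the quadruples gives p + a1 = a2 + a3 and its variants, so all doubles
    coincide. *)
Lemma six_even ps a1 b1 a2 b2 a3 b3 q : six_config ps a1 b1 a2 b2 a3 b3 ->
  q \in ps -> cls q.1 = cls a1 + cls a2 + cls a3 ->
  q.1 + q.2 = a1 + a1 /\
  {in [:: a1; b1; a2; b2; a3; b3], forall z, z + z = a1 + a1}.
Proof.
move=> C; have [cp pe sp h12 h23] := C.
have [s12 s23 [x [y [mx my g [cx cy sxy]]]]] := six_sums C.
case: q => p q /= qin Ep; have pq := perm_to_rem qin; move: (rem _ ps) pq => ps' pq.
have cpq : cls p = cls q by apply/eqP; apply: (allP cp _ qin).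
have Q r r' a b c R : perm_eq [:: p; q] [:: r; r'] -> cls r = cls p ->
    cls a + cls b + cls c = cls p ->
    perm_eq [:: a1; b1; a2; b2; a3; b3] ([:: a; b; c] ++ R) -> r + a + b + c = x + y.
  move=> prr kr kp pr; have cps z : (count_mem z (pair_sums ps) - 1 <= count_mem z (pair_sums ps'))%N.
    have := seq.permP (perm_map (fun q => q.1 + q.2) pq) (pred1 z).
    rewrite /= => ->; case: (_ == z) => /=; move: (count _ _) => i; clear; lia.
  apply: (@quadruple_sum ps' r a b c (r' :: R) x y _ _ mx my g).
  - apply/seq.permP => P; move: (seq.permP pe P) (seq.permP (perm_unpair pq) P).
    by move: (seq.permP prr P) (seq.permP pr P); count_lia.
  - by rewrite !raddfD kr -!addrA (addrA (cls a)) kp addTT.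
  - by apply: leq_trans (cps x); rewrite cx -subnDA.
  by apply: leq_trans (cps y); rewrite cy -subnDA.
have kb2 : cls b1 = cls a1 + cls a2 + cls b2.
  by rewrite -addrA -h12 addrA addTT add0r.
have kb3 : cls b3 = cls a2 + cls b2 + cls a3 by rewrite h23 addrC addrA addTT add0r.
have kb2' : cls b2 = cls a1 + cls b1 + cls a2 by rewrite h12 addrC addrA addTT add0r.
have K r r' : perm_eq [:: p; q] [:: r; r'] -> cls r = cls p ->
   [/\ r + a1 = a2 + a3, r + a2 = a1 + a3 & r + a3 = a1 + a2].
  move=> prr kr.
  have Q0 : r + a1 + a2 + a3 = x + y by apply: (Q r r' _ _ _ [:: b1; b2; b3] prr kr);
    [rewrite Ep | apply/seq.permP => P; count_lia].
  have Q1 : r + a1 + b2 + b3 = x + y.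
    apply: (Q r r' _ _ _ [:: b1; a2; a3] prr kr); last by apply/seq.permP => P; count_lia.
    rewrite Ep kb3; apply/eqP; rewrite -subr_eq0; apply/eqP.
    by apply: (@eq_add0 _ (cls b2)); ring.
  have Q2 : r + b1 + a2 + b3 = x + y.
    apply: (Q r r' _ _ _ [:: a1; b2; a3] prr kr); last by apply/seq.permP => P; count_lia.
    rewrite Ep kb3 kb2; apply/eqP; rewrite -subr_eq0; apply/eqP.
    by apply: (@eq_add0 _ (cls b2 + cls a2)); ring.
  have Q3 : r + b1 + b2 + a3 = x + y.
    apply: (Q r r' _ _ _ [:: a1; a2; b3] prr kr); last by apply/seq.permP => P; count_lia.
    rewrite Ep kb2; apply/eqP; rewrite -subr_eq0; apply/eqP.
    by apply: (@eq_add0 _ (cls b2)); ring.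
  have Eb1 : b1 = a2 + b2 - a1 by rewrite -s12; group_ring.
  have Eb3 : b3 = a2 + b2 - a3 by rewrite s23; group_ring.
  have Exy : x + y = a2 + b2 + (a2 + b2) by rewrite -s12 sxy.
  split.
  - have -> : r + a1 = (r + a1 + b2 + b3) - (a2 + b2 + (a2 + b2)) + a2 + a3 by rewrite Eb3; group_ring.
    by rewrite Q1 Exy; group_ring.
  - have -> : r + a2 = (r + b1 + a2 + b3) - (a2 + b2 + (a2 + b2)) + a1 + a3
      by rewrite Eb1 Eb3; group_ring.
    by rewrite Q2 Exy; group_ring.
  have -> : r + a3 = (r + b1 + b2 + a3) - (a2 + b2 + (a2 + b2)) + a1 + a2 by rewrite Eb1; group_ring.
  by rewrite Q3 Exy; group_ring.
have [p1 p2 p3] := K p q (perm_refl _) erefl.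
have [q1 _ _] := K q p (permEl (perm_catC [:: p] [:: q])) (esym cpq).
have Epq : q = p by apply: (addIr a1); rewrite p1 q1.
have d12 : a2 + a2 = a1 + a1.
  have -> : a2 + a2 = (p + a2) - (p + a1) + a2 + a1 by group_ring.
  by rewrite p1 p2; group_ring.
have d13 : a3 + a3 = a1 + a1.
  have -> : a3 + a3 = (p + a3) - (p + a1) + a3 + a1 by group_ring.
  by rewrite p1 p3; group_ring.
have dp : p + p = a1 + a1.
  have -> : p + p = (p + a1) + (p + a2) - a1 - a2 by group_ring.
  by rewrite p1 p2 -d13; group_ring.
have Q0 : p + a1 + a2 + a3 = x + y.
  by apply: (Q p q _ _ _ [:: b1; b2; b3] (perm_refl _) erefl);
    [rewrite Ep | apply/seq.permP => P; count_lia].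
have S2 : a1 + b1 + (a1 + b1) = a1 + a1 + (a1 + a1).
  by rewrite sxy -Q0 p1 -{1}d12 -d13; group_ring.
have dB a b : a + b = a1 + b1 -> a + a = a1 + a1 -> b + b = a1 + a1.
  move=> Eab Ea; have -> : b + b = (a + b) + (a + b) - (a + a) by group_ring.
  by rewrite Eab Ea S2; group_ring.
rewrite Epq dp; split=> // z; rewrite !inE.
case/or4P => [/eqP->//|/eqP->|/eqP->//|/or3P[]/eqP->//].
- exact: dB erefl _.
- by apply: dB d12; rewrite s12.
by apply: dB d13; rewrite s12 s23.
Qed.

Lemma six_odd_pair ps a1 b1 a2 b2 a3 b3 q : six_config ps a1 b1 a2 b2 a3 b3 ->
  q \in ps -> cls q.1 \in [seq cls z | z <- [:: a1; b1; a2; b2; a3; b3]] ->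
  q.1 = q.2 /\ q.1 \in [:: a1; b1; a2; b2; a3; b3].
Proof.
move=> C qin; have sw a b a' b' a'' b'' : six_config ps a b a' b' a'' b'' ->
    cls q.1 = cls a -> a \in [:: a1; b1; a2; b2; a3; b3] ->
    q.1 = q.2 /\ q.1 \in [:: a1; b1; a2; b2; a3; b3].
  by move=> C' E ain; have [-> ->] := six_swap C' qin E.
move=> h; rewrite /= !inE in h; case/or4P: h => [/eqP|/eqP|/eqP|/or3P[]/eqP] E.
- by apply: (@sw _ _ _ _ _ _ C E); rewrite !inE eqxx ?orbT.
- by apply: (@sw _ _ _ _ _ _ (six_flip C) E); rewrite !inE eqxx ?orbT.
- by apply: (@sw _ _ _ _ _ _ (six_rot C) E); rewrite !inE eqxx ?orbT.
- by apply: (@sw _ _ _ _ _ _ (six_flip (six_rot C)) E); rewrite !inE eqxx ?orbT.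
- by apply: (@sw _ _ _ _ _ _ (six_rot (six_rot C)) E); rewrite !inE eqxx ?orbT.
by apply: (@sw _ _ _ _ _ _ (six_flip (six_rot (six_rot C))) E); rewrite !inE eqxx ?orbT.
Qed.

Lemma six_flip_all ps a1 b1 a2 b2 a3 b3 : six_config ps a1 b1 a2 b2 a3 b3 ->
  six_config ps b1 a1 b2 a2 b3 a3.
Proof. by move/six_flip/six_rot/six_flip/six_rot/six_flip/six_rot. Qed.

(** One such pair would make every pair sum equal to 2 a1, whereas the distinct values x and y both
    occur. *)
Lemma six_no_even ps a1 b1 a2 b2 a3 b3 : six_config ps a1 b1 a2 b2 a3 b3 ->
  (forall q, q \in ps -> [\/ q.1 = q.2 /\ q.1 \in [:: a1; b1; a2; b2; a3; b3],
      cls q.1 = cls a1 + cls a2 + cls a3 | cls q.1 = cls b1 + cls b2 + cls b3]) ->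
  forall q, q \in ps -> cls q.1 <> cls a1 + cls a2 + cls a3.
Proof.
move=> C tri q qin Eq; have [_ dbl] := six_even C qin Eq.
have const z : z \in pair_sums ps -> z = a1 + a1.
  case/mapP => r rin ->; case: (tri r rin) => [[<- rs]|Er|Er].
  - exact: dbl.
  - by have [-> _] := six_even C rin Er.
  have [-> _] := six_even (six_flip_all C) rin Er.
  by apply: dbl; rewrite !inE eqxx orbT.
have [_ _ [x [y [_ _ g [cx cy _]]]]] := six_sums C.
have mem z : count_mem z (pair_sums ps) = (n - 1)%N -> z = a1 + a1.
  move=> cz; have : has (pred1 z) (pair_sums ps) by rewrite has_count cz subn_gt0.
  by case/hasP => t /const -> /eqP.
by have /eqP := generates_neq g; rewrite (mem x cx) (mem y cy).
Qed.

Lemma count_six (ps : seq (G * G)) (a1 b1 a2 b2 a3 b3 : G) :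
  (forall q, q \in ps -> q.1 = q.2 /\ q.1 \in [:: a1; b1; a2; b2; a3; b3]) ->
  exists k1 l1 k2 l2 k3 l3 : nat,
  perm_eq (unpair ps) (nseq (2 * k1) a1 ++ nseq (2 * l1) b1 ++ nseq (2 * k2) a2 ++
     nseq (2 * l2) b2 ++ nseq (2 * k3) a3 ++ nseq (2 * l3) b3) /\
  perm_eq (pair_sums ps) (nseq k1 (a1 + a1) ++ nseq l1 (b1 + b1) ++ nseq k2 (a2 + a2) ++
     nseq l2 (b2 + b2) ++ nseq k3 (a3 + a3) ++ nseq l3 (b3 + b3)).
Proof.
elim: ps => [|[p q] ps IH] h; first by exists 0%N, 0%N, 0%N, 0%N, 0%N, 0%N.
have [|k1 [l1 [k2 [l2 [k3 [l3 [E1 E2]]]]]]] := IH; first by move=> r rin; apply: h; rewrite inE rin orbT.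
have [/= <- {h}] := h _ (mem_head _ _).
rewrite !inE => /or4P[/eqP|/eqP|/eqP|/or3P[]/eqP] ->.
- exists k1.+1, l1, k2, l2, k3, l3; rewrite mulnS !addSn add0n /=; split; apply/seq.permP => P.
    by move: (seq.permP E1 P); count_lia.
  by move: (seq.permP E2 P); count_lia.
- exists k1, l1.+1, k2, l2, k3, l3; rewrite mulnS !addSn add0n /=; split; apply/seq.permP => P.
    by move: (seq.permP E1 P); count_lia.
  by move: (seq.permP E2 P); count_lia.
- exists k1, l1, k2.+1, l2, k3, l3; rewrite mulnS !addSn add0n /=; split; apply/seq.permP => P.
    by move: (seq.permP E1 P); count_lia.
  by move: (seq.permP E2 P); count_lia.
- exists k1, l1, k2, l2.+1, k3, l3; rewrite mulnS !addSn add0n /=; split; apply/seq.permP => P.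
    by move: (seq.permP E1 P); count_lia.
  by move: (seq.permP E2 P); count_lia.
- exists k1, l1, k2, l2, k3.+1, l3; rewrite mulnS !addSn add0n /=; split; apply/seq.permP => P.
    by move: (seq.permP E1 P); count_lia.
  by move: (seq.permP E2 P); count_lia.
exists k1, l1, k2, l2, k3, l3.+1; rewrite mulnS !addSn add0n /=; split; apply/seq.permP => P.
  by move: (seq.permP E1 P); count_lia.
by move: (seq.permP E2 P); count_lia.
Qed.

(** The numbers k_i and l_i count the pairs (a_i, a_i) and (b_i, b_i), so [U] is the list of pair
    sums; the remaining copy of each value makes the multiplicities odd. *)
Definition odd_blocks (x y a1 : G) k1 (b1 : G) l1 (a2 : G) k2 (b2 : G) l2 (a3 : G) k3 (b3 : G) l3 :=
  let U := nseq k1 (a1 + a1) ++ nseq l1 (b1 + b1) ++ nseq k2 (a2 + a2) ++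
           nseq l2 (b2 + b2) ++ nseq k3 (a3 + a3) ++ nseq l3 (b3 + b3) in
  [/\ perm_eq S (nseq (2 * k1 + 1) a1 ++ nseq (2 * l1 + 1) b1 ++ nseq (2 * k2 + 1) a2 ++
                 nseq (2 * l2 + 1) b2 ++ nseq (2 * k3 + 1) a3 ++ nseq (2 * l3 + 1) b3),
      uniq [seq cls g | g <- [:: a1; b1; a2; b2; a3; b3]],
      a1 + b1 = a2 + b2 /\ a2 + b2 = a3 + b3,
      a1 + b1 + (a1 + b1) = x + y &
      [/\ generates e n (x - y), count_mem x U = (n - 1)%N, count_mem y U = (n - 1)%N &
          forall z, z \in U -> z = x \/ z = y]].

(** The classes c and c + v are the two that R misses; a frame built on their difference v arranges
    the other six in couples. *)
Lemma six_rest (R : seq G) : uniq [seq cls g | g <- R] -> size R = 6%N ->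
  exists c v u w a1 b1 a2 b2 a3 b3, [/\ uniq (frame v u w),
    perm_eq R [:: a1; b1; a2; b2; a3; b3] &
    [:: c; c + v] ++ [seq cls g | g <- [:: a1; b1; a2; b2; a3; b3]]
       = [seq c + t | t <- frame v u w]].
Proof.
move=> uR sR; pose M := [seq t <- enum {: classes3} | t \notin [seq cls g | g <- R]].
have uM : uniq M by rewrite filter_uniq ?enum_uniq.
have uMR : uniq (M ++ [seq cls g | g <- R]).
  rewrite cat_uniq uM uR andbT /=; apply/hasPn => t tR.
  by rewrite mem_filter tR.
have sM : size (M ++ [seq cls g | g <- R]) = 8%N.
  have <- : #|{: classes3}| = 8%N by rewrite !card_prod !card_ord.
  rewrite cardE; apply: perm_size; apply: uniq_perm; rewrite ?enum_uniq // => t.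
  by rewrite mem_cat mem_filter mem_enum andbT orbC; case: (_ \in _).
have {sM}: size M = 2%N by move: sM; rewrite size_cat size_map sR; move: (size M) => i; clear; lia.
case: M uM uMR => [|c [|m [|//]]] // uM uMR _.
have nv : m - c != 0.
  by move: uM; rewrite /= inE andbT subr_eq0 eq_sym.
have [u [w uf]] := frame_exists nv; have uf' := frame_perm c uf.
have pe : perm_eq ([:: c; m] ++ [seq cls g | g <- R]) [seq c + t | t <- frame (m - c) u w].
  apply: uniq_perm => // t; rewrite !uniq_all_T ?size_map //.
  by rewrite /= size_map sR.
have Em : c + (m - c) = m by rewrite addrC subrK.
rewrite /= addr0 Em !perm_cons in pe.
have [R' pR ER] := perm_map_lift pe.
exists c, (m - c), u, w.
have := perm_size pR; rewrite sR.
case: R' pR ER => [|a1 [|b1 [|a2 [|b2 [|a3 [|b3 [|//]]]]]]] // pR ER _.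
exists a1, b1, a2, b2, a3, b3; split=> //.
by rewrite -ER /= addr0 Em.
Qed.

Lemma odd_blocks_exist : size S = (4 * n + 2)%N ->
  exists x y a1 k1 b1 l1 a2 k2 b2 l2 a3 k3 b3 l3,
    odd_blocks x y a1 k1 b1 l1 a2 k2 b2 l2 a3 k3 b3 l3.
Proof.
move=> szS; have [ps [R [cp pe uR]]] := maximal_pairing S.
have lt := few_pairs cp pe.
have sR : (size R <= 8)%N.
  have -> : 8%N = #|{: classes3}| by rewrite !card_prod !card_ord.
  rewrite -(size_map cls) -(card_uniqP uR); exact: max_card.
have := perm_size pe; rewrite size_cat size_unpair szS => sz.
have [sR8|sR6] : size R = 8%N \/ size R = 6%N.
  by move: (size R) (size ps) sR lt sz => r p; clear; lia.
  case: (no_eight_classes cp pe _ uR sR8).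
  by move: sz; rewrite sR8; move: (size ps) => p; clear; lia.
have [c [v [u [w [a1 [b1 [a2 [b2 [a3 [b3 [uf pR E]]]]]]]]]]] := six_rest uR sR6.
have uf' := frame_perm c uf.
have all8 t : t \in [:: c; c + v] ++ [seq cls g | g <- [:: a1; b1; a2; b2; a3; b3]].
  by rewrite E; apply: uniq_all_T; rewrite ?size_map.
have u6 : uniq [seq cls g | g <- [:: a1; b1; a2; b2; a3; b3]].
  by move: uf'; rewrite -E cat_uniq => /and3P[].
case: E => _ E1 F1 E2 F2 E3 F3.
have C : six_config ps a1 b1 a2 b2 a3 b3.
  split=> //.
  - by rewrite (permPl pe) perm_cat2l.
  - by move: sz; rewrite sR6; move: (size ps) => p; clear; lia.
  - rewrite E1 E2 F1 F2; apply/eqP; rewrite -subr_eq0; apply/eqP.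
    by apply: (@eq_add0 _ (u - w)); ring.
  rewrite E3 E2 F3 F2; apply/eqP; rewrite -subr_eq0; apply/eqP.
  by apply: (@eq_add0 _ (- u)); ring.
(* The missing classes are the sum of the classes of the a_i and that of the b_i, the form in which
   [six_even] handles them. *)
have Ec : cls a1 + cls a2 + cls a3 = c.
  rewrite E1 E2 E3; apply/eqP; rewrite -subr_eq0; apply/eqP.
  by apply: (@eq_add0 _ (c + u + w)); ring.
have Ecv : cls b1 + cls b2 + cls b3 = c + v.
  rewrite F1 F2 F3; apply/eqP; rewrite -subr_eq0; apply/eqP.
  by apply: (@eq_add0 _ (c + u + w + v)); ring.
have tri q : q \in ps -> [\/ q.1 = q.2 /\ q.1 \in [:: a1; b1; a2; b2; a3; b3],
      cls q.1 = cls a1 + cls a2 + cls a3 | cls q.1 = cls b1 + cls b2 + cls b3].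
  move=> qin; have := all8 (cls q.1); rewrite mem_cat => /orP[|h]; last first.
    by apply: Or31; apply: (six_odd_pair C qin h).
  by move=> h; rewrite !inE in h; case/orP: h => /eqP ->; [apply: Or32 | apply: Or33].
have noA := six_no_even C tri.
have noB : forall q, q \in ps -> cls q.1 <> cls b1 + cls b2 + cls b3.
  apply: (six_no_even (six_flip_all C)) => q qin.
  case: (tri q qin) => [[E q6]|E|E]; [apply: Or31; split=> //|exact: Or33|exact: Or32].
  by move: q6; rewrite !inE => /or4P[|||/or3P[]] ->; rewrite ?orbT.
have diag q : q \in ps -> q.1 = q.2 /\ q.1 \in [:: a1; b1; a2; b2; a3; b3].
  by move=> qin; case: (tri q qin) => // [/(noA q qin)|/(noB q qin)].
have [k1 [l1 [k2 [l2 [k3 [l3 [P1 P2]]]]]]] := count_six diag.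
have [s12 s23 [x [y [_ _ g [cx cy sxy]]]]] := six_sums C.
exists x, y, a1, k1, b1, l1, a2, k2, b2, l2, a3, k3, b3, l3; split=> //.
  rewrite (permPl pe); apply/seq.permP => P; move: (seq.permP P1 P) (seq.permP pR P).
  by rewrite !addn1 /=; count_lia.
have tv := two_values (generates_neq g) cx cy _.
split=> //; rewrite -?(seq.permP P2) // => z; rewrite -(perm_mem P2); apply: tv.
by rewrite size_map; have [_ _ -> _ _] := C.
Qed.
End Pairs.

(** * From six odd multiplicities to the three families *)

(** Every element being its own opposite, a non-empty [L] closed under addition is a subgroup;
    adjoining the coset of t gives a subgroup twice as large. *)
Lemma double_uniq (L : seq classes3) t : uniq L -> {in L &, forall x y, x + y \in L} -> t \notin L ->
  uniq (L ++ [seq t + x | x <- L]) /\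
  {in L ++ [seq t + x | x <- L] &, forall x y, x + y \in L ++ [seq t + x | x <- L]}.
Proof.
move=> uL cL nt; split.
  rewrite cat_uniq uL map_inj_uniq ?uL ?andbT /=; last exact: addrI.
  apply/hasPn => _ /mapP[x xL ->]; apply: contra nt => h.
  by have := cL _ _ h xL; rewrite -addrA addTT addr0.
have cst x y : x \in L -> y \in L -> t + x + y \in L ++ [seq t + x | x <- L].
  by move=> xL yL; rewrite mem_cat -addrA map_f ?orbT ?cL.
move=> x y; rewrite !(mem_cat x) !(mem_cat y).
case/orP => [xL|/mapP[x' xL ->]] /orP[yL|/mapP[y' yL ->]].
- by rewrite mem_cat cL.
- by rewrite addrC; apply: cst.
- exact: cst.
by rewrite addrACA addTT add0r mem_cat cL.
Qed.

(** Linear independence over Z_2: each class lies outside the listed span of the previous ones. *)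
Definition independent_classes (t3 t2 t1 : classes3) :=
  [/\ t3 != 0, t2 \notin [:: 0; t3] & t1 \notin [:: 0; t3; t2; t2 + t3]].

Lemma independent_classes_frame t3 t2 t1 :
  independent_classes t3 t2 t1 -> uniq (frame t3 t2 t1).
Proof.
case=> n3 n2 n1.
have [|x y|u2 c2] := @double_uniq [:: 0; t3] t2 _ _ n2.
- by rewrite /= inE andbT eq_sym.
- by rewrite !inE => /orP[]/eqP-> /orP[]/eqP->; rewrite ?addTT ?add0r ?addr0 ?eqxx ?orbT.
have E : [:: 0; t3] ++ [seq t2 + x | x <- [:: 0; t3]] = [:: 0; t3; t2; t2 + t3].
  by rewrite /= addr0.
rewrite E in u2 c2; have [u1 _] := double_uniq u2 c2 n1.
have <- : [:: 0; t3; t2; t2 + t3] ++ [seq t1 + x | x <- [:: 0; t3; t2; t2 + t3]] = frame t3 t2 t1.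
  by rewrite /frame /= addr0 addrA (addrC t1 t2).
exact: u1.
Qed.

Lemma mulrz_T (t : classes3) (a : int) : t *~ a = if odd `|a|%N then t else 0.
Proof.
have E m : t *+ m = if odd m then t else 0.
  by elim: m => //= m IH; rewrite mulrS IH; case: (odd m); rewrite ?addr0 ?addTT.
case: a => m /=; first by rewrite -pmulrn E.
rewrite NegzE mulrNz -pmulrn E /=; case: (odd m) => /=; first by rewrite oppr0.
by apply/eqP; rewrite eq_sym -addr_eq0 addTT.
Qed.

(** A unitriangular change of basis. On classes, it is the effect of correcting f1 and f2 by
    multiples of f3 to make their doubles vanish. *)
Lemma independent_classes_shift t3 t2 t1 s2 s1 : s2 \in [:: 0; t3] -> s1 \in [:: 0; t3] ->
  independent_classes t3 t2 t1 -> independent_classes t3 (t2 + s2) (t1 + s1).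
Proof.
have K (x y : classes3) : x + y + y = x by rewrite -addrA addTT addr0.
have M (x y z : classes3) : (x + z == y) = (x == y + z).
  by apply/eqP/eqP => [<-|->]; rewrite K.
move=> h2 h1 [n3 n2 n1]; split=> //; rewrite !inE in h1 h2 n1 n2 *.
  by apply: contra n2; case/orP: h2 => /eqP->; rewrite ?addr0 ?M ?add0r ?addTT //; rewrite orbC.
by apply: contra n1; case/orP: h1 => /eqP->; case/orP: h2 => /eqP->;
  rewrite ?addr0 ?K ?M ?K ?add0r ?addTT; case/or4P => ->; rewrite ?orbT.
Qed.

Section Families.
Variables (G : finZmodType) (e : G) (n : nat).
Hypotheses (n1 : (1 < n)%N) (e_order : forall z : int, (e *~ z == 0) = (n %| z)%Z).
Variable cls : {additive G -> classes3}.
Hypothesis cls_ker : forall g, cls g = 0 -> multiple e g.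
Variables (A : comNzRingType) (phi : {additive G -> A}).
Hypothesis phi_inj : injective phi.

Ltac group_ring :=
  apply: phi_inj; rewrite ?(raddfMn phi, raddfMz phi, raddf0 phi, raddfD phi, raddfN phi); ring.

Lemma double_order (f : G) : cls f != 0 -> generates e n (f + f) -> #[f]%g = (2 * n)%N.
Proof.
move=> cf g; have key k : f *+ k = 0 -> (2 * n %| k)%N.
  move=> E; have := congr1 cls E; rewrite raddf0 raddfMn.
  rewrite -[cls f *+ k]/(cls f *~ k) mulrz_T /=; case: (boolP (odd k)) => [_ E0|ok _].
    by rewrite E0 eqxx in cf.
  have Ek : k = (2 * k./2)%N by rewrite mul2n -[LHS]odd_double_half (negbTE ok).
  rewrite Ek dvdn_pmul2l //; apply: g.2.
  by rewrite -mulr2n -mulrnA -Ek.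
apply/eqP; rewrite eqn_dvd order_dvdn FinRing.zmodXgE FinRing.zmod1gE.
apply/andP; split; last by apply: key; rewrite -FinRing.zmodXgE expg_order.
rewrite mulrnA mulr2n; apply/eqP.
exact: (multiple_mulrn e_order (cls_ker (etrans (raddfD cls f f) (addTT _)))).
Qed.

Lemma order2 (f : G) : cls f != 0 -> f + f = 0 -> #[f]%g = 2%N.
Proof.
move=> cf ff; have f2 : (f ^+ 2 = 1)%g by rewrite FinRing.zmodXgE mulr2n ff.
apply: nt_prime_order => //.
by apply: contra cf => /eqP->; rewrite FinRing.zmod1gE raddf0.
Qed.

(** In a relation, passing to classes shows that the coefficients of f1 and f2 are even, so these
    terms vanish and the third one with them. The subset sums of f1, f2, f3 meet all eight classes,
    and the multiples of 2 f3 fill 2G. *)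
Lemma basis_of_classes (f1 f2 f3 : G) : f1 + f1 = 0 -> f2 + f2 = 0 -> generates e n (f3 + f3) ->
  independent_classes (cls f3) (cls f2) (cls f1) ->
  [/\ is_basis [tuple f1; f2; f3], #[f1]%g = 2%N, #[f2]%g = 2%N & #[f3]%g = (2 * n)%N].
Proof.
move=> d1 d2 g ind; have uf := independent_classes_frame ind.
have [n3 n2 n1'] := ind.
have c2 : cls f2 != 0 by move: n2; rewrite !inE negb_or => /andP[].
have c1 : cls f1 != 0 by move: n1'; rewrite !inE negb_or => /andP[].
split; [split | exact: order2 | exact: order2 | exact: double_order].
  move=> a; rewrite !big_ord_recl big_ord0 !(tnth_nth 0) /= addr0 => E.
  have even (f : G) z : f + f = 0 -> ~~ odd `|z|%N -> f *~ z = 0.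
    move=> ff; case: z => m /= om.
      by rewrite -pmulrn -[m]odd_double_half (negbTE om) -mul2n mulrnA mulr2n ff mul0rn.
    rewrite NegzE mulrNz -pmulrn -[m.+1]odd_double_half /= (negbTE om) -mul2n mulrnA mulr2n ff.
    by rewrite mul0rn oppr0.
  have := congr1 cls E; rewrite raddf0 !raddfD !raddfMz !mulrz_T.
  move=> Ec; have [o1 o2] : odd `|a ord0|%N = false /\ odd `|a (lift ord0 ord0)|%N = false.
    have eqT (x y : classes3) : x + y = 0 -> x = y.
      by move=> xy; apply: (addIr y); rewrite xy addTT.
    move: Ec n1' n2; rewrite !inE !negb_or; case: (odd _) => [/eqT ->|].
      case: (odd _); case: (odd _); rewrite ?addr0 ?add0r !eqxx ?andbF //.
    by rewrite add0r; case: (odd _) => // /eqT ->; case: (odd _); rewrite eqxx ?andbF.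
  have z1 : f1 *~ a ord0 = 0 by apply: even; rewrite ?o1.
  have z2 : f2 *~ a (lift ord0 ord0) = 0 by apply: even; rewrite ?o2.
  move=> i; rewrite (tnth_nth 0); case: i => [[|[|[|//]]] lti] /=.
  - by rewrite (_ : Ordinal lti = ord0) //; apply: val_inj.
  - by rewrite (_ : Ordinal lti = lift ord0 ord0) //; apply: val_inj.
  rewrite (_ : Ordinal lti = lift ord0 (lift ord0 ord0)); last exact: val_inj.
  by move: E; rewrite z1 z2 !add0r.
apply/setP => h; rewrite [RHS]inE; set H := <<_>>%g.
have HD x y : x \in H -> y \in H -> x + y \in H by apply: groupM.
have HX x k : x \in H -> x *+ k \in H by apply: groupX.
have H0 : 0 \in H by apply: group1.
have Hf f : f \in [:: f1; f2; f3] -> f \in H by move=> fin; apply: mem_gen; rewrite inE.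
have H1 : f1 \in H by apply: Hf; rewrite !inE eqxx.
have H2 : f2 \in H by apply: Hf; rewrite !inE eqxx orbT.
have H3 : f3 \in H by apply: Hf; rewrite !inE eqxx !orbT.
have [h' h'H Eh] : exists2 h', h' \in H & cls h' = cls h.
  have /mapP[h' h'in ->] : cls h \in [seq cls x | x <- [:: 0; f3; f2; f2 + f3; f1; f1 + f3; f2 + f1; f2 + f1 + f3]].
    by rewrite /= !raddfD raddf0; apply: (uniq_all_T _ uf).
  exists h' => //; move: h' h'in; apply/allP.
  by rewrite /= ?H0 ?H1 ?H2 ?H3 !HD // HD.
have [|j _ Ej] := g.1 (h - h').
  by apply: cls_ker; rewrite raddfB Eh subrr.
by rewrite -(subrK h' h) Ej HD ?HX ?HD.
Qed.

Variable S : seq G.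
Local Notation odd_blocks := (odd_blocks e n cls S).

Lemma odd_blocks_rot x y a1 k1 b1 l1 a2 k2 b2 l2 a3 k3 b3 l3 :
  odd_blocks x y a1 k1 b1 l1 a2 k2 b2 l2 a3 k3 b3 l3 ->
  odd_blocks x y a2 k2 b2 l2 a3 k3 b3 l3 a1 k1 b1 l1.
Proof.
case=> pe u [s12 s23] sxy [g cx cy xy].
have pU : perm_eq (nseq k1 (a1 + a1) ++ nseq l1 (b1 + b1) ++ nseq k2 (a2 + a2) ++
           nseq l2 (b2 + b2) ++ nseq k3 (a3 + a3) ++ nseq l3 (b3 + b3))
  (nseq k2 (a2 + a2) ++ nseq l2 (b2 + b2) ++ nseq k3 (a3 + a3) ++
           nseq l3 (b3 + b3) ++ nseq k1 (a1 + a1) ++ nseq l1 (b1 + b1)).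
  by apply/seq.permP => P; count_lia.
split.
- by apply/seq.permP => P; move: (seq.permP pe P); count_lia.
- rewrite -(perm_uniq (s1 := [seq cls g | g <- [:: a1; b1; a2; b2; a3; b3]])) //.
  by apply: perm_map; apply/seq.permP => P; count_lia.
- by rewrite -s23 s12.
- by rewrite -s12.
by split=> // [||z]; rewrite -?(seq.permP pU) // -(perm_mem pU); apply: xy.
Qed.

Lemma odd_blocks_swap x y a1 k1 b1 l1 a2 k2 b2 l2 a3 k3 b3 l3 :
  odd_blocks x y a1 k1 b1 l1 a2 k2 b2 l2 a3 k3 b3 l3 ->
  odd_blocks x y a1 k1 b1 l1 a3 k3 b3 l3 a2 k2 b2 l2.
Proof.
case=> pe u [s12 s23] sxy [g cx cy xy].
have pU : perm_eq (nseq k1 (a1 + a1) ++ nseq l1 (b1 + b1) ++ nseq k2 (a2 + a2) ++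
           nseq l2 (b2 + b2) ++ nseq k3 (a3 + a3) ++ nseq l3 (b3 + b3))
  (nseq k1 (a1 + a1) ++ nseq l1 (b1 + b1) ++ nseq k3 (a3 + a3) ++
           nseq l3 (b3 + b3) ++ nseq k2 (a2 + a2) ++ nseq l2 (b2 + b2)).
  by apply/seq.permP => P; count_lia.
split.
- by apply/seq.permP => P; move: (seq.permP pe P); count_lia.
- rewrite -(perm_uniq (s1 := [seq cls g | g <- [:: a1; b1; a2; b2; a3; b3]])) //.
  by apply: perm_map; apply/seq.permP => P; count_lia.
- by rewrite -s23.
- by [].
by split=> // [||z]; rewrite -?(seq.permP pU) // -(perm_mem pU); apply: xy.
Qed.

Lemma odd_blocks_flip x y a1 k1 b1 l1 a2 k2 b2 l2 a3 k3 b3 l3 :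
  odd_blocks x y a1 k1 b1 l1 a2 k2 b2 l2 a3 k3 b3 l3 ->
  odd_blocks x y b1 l1 a1 k1 a2 k2 b2 l2 a3 k3 b3 l3.
Proof.
case=> pe u [s12 s23] sxy [g cx cy xy].
have pU : perm_eq (nseq k1 (a1 + a1) ++ nseq l1 (b1 + b1) ++ nseq k2 (a2 + a2) ++
           nseq l2 (b2 + b2) ++ nseq k3 (a3 + a3) ++ nseq l3 (b3 + b3))
  (nseq l1 (b1 + b1) ++ nseq k1 (a1 + a1) ++ nseq k2 (a2 + a2) ++
           nseq l2 (b2 + b2) ++ nseq k3 (a3 + a3) ++ nseq l3 (b3 + b3)).
  by apply/seq.permP => P; count_lia.
split.
- by apply/seq.permP => P; move: (seq.permP pe P); count_lia.
- rewrite -(perm_uniq (s1 := [seq cls g | g <- [:: a1; b1; a2; b2; a3; b3]])) //.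
  by apply: perm_map; apply/seq.permP => P; count_lia.
- by rewrite addrC.
- by rewrite (addrC b1).
by split=> // [||z]; rewrite -?(seq.permP pU) // -(perm_mem pU); apply: xy.
Qed.

(* Whether the doubles of the i-th pair of values are the two pair sums; if
   not, both values occur only once. *)
Definition good (x y a b : G) := a + a = x /\ b + b = y.
Definition bad (x y a : G) (k l : nat) := [/\ a + a <> x, a + a <> y, k = 0%N & l = 0%N].

(** Since 2 a1 + 2 b1 = x + y, one double is x exactly when the other is y. If a double is neither,
    no pair of that value exists, all pair sums being x or y. *)
Lemma good_or_bad x y a1 k1 b1 l1 a2 k2 b2 l2 a3 k3 b3 l3 :
  odd_blocks x y a1 k1 b1 l1 a2 k2 b2 l2 a3 k3 b3 l3 ->
  [\/ good x y a1 b1, good x y b1 a1 | bad x y a1 k1 l1].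
Proof.
case=> _ _ _ sxy [_ _ _ xy].
have E : b1 + b1 = x + y - (a1 + a1) by rewrite -sxy; group_ring.
have [ax|/eqP ax] := eqVneq (a1 + a1) x.
  by apply: Or31; split=> //; rewrite E ax; group_ring.
have [ay|/eqP ay] := eqVneq (a1 + a1) y.
  by apply: Or32; split=> //; rewrite E ay; group_ring.
apply: Or33; split=> //.
  case: k1 xy => // k1 /(_ (a1 + a1)); rewrite inE eqxx => /(_ isT)[/ax|/ay] //.
case: l1 xy => // l1 /(_ (b1 + b1)); rewrite mem_cat orbC inE eqxx => /(_ isT).
have Ea : a1 + a1 = x + y - (b1 + b1) by rewrite E; group_ring.
by case=> Eb; [case: ay | case: ax]; rewrite Ea Eb; group_ring.
Qed.

Definition structured :=
  exists f1 f2 f3 f : G,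
    [/\ is_basis [tuple f1; f2; f3],
        #[f1]%g = 2%N, #[f2]%g = 2%N, #[f3]%g = (2 * n)%N &
        [\/ family_s1 n f1 f2 f3 (translate (- f) S),
            family_s2 n f1 f2 f3 (translate (- f) S) |
            family_s3 n f1 f2 f3 (translate (- f) S)]].

Lemma generatesN d : generates e n d -> generates e n (- d).
Proof.
case=> sp od; split=> [q mq|j E].
  have [j ltj Ej] := sp _ (multipleN mq); exists j => //.
  by rewrite mulNrn -Ej opprK.
by apply: od; apply/eqP; rewrite -oppr_eq0 -mulNrn E.
Qed.

(** The two triples differ in the choice of f3: b1 - a1 for (s2) and (s3), b2 - a1 for (s1). *)
Lemma independent_of_six a1 b1 a2 b2 a3 b3 :
  uniq [seq cls g | g <- [:: a1; b1; a2; b2; a3; b3]] -> a1 + b1 = a2 + b2 -> a2 + b2 = a3 + b3 ->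
  independent_classes (cls (b1 - a1)) (cls (a2 - a1)) (cls (a3 - a1)) /\
  independent_classes (cls (b2 - a1)) (cls (a2 - a1)) (cls (a3 - a1)).
Proof.
move=> u s12 s23.
have N z t : cls z != cls t -> cls (z - a1) != cls (t - a1).
  by rewrite !raddfB (inj_eq (addIr _)).
have N0 z : cls z != cls a1 -> cls (z - a1) != 0.
  by rewrite raddfB subr_eq0.
have D z t w : z + t = w + a1 -> cls (z - a1) + cls (t - a1) = cls (w - a1).
  move=> E; rewrite -raddfD (_ : z - a1 + (t - a1) = w - a1) //.
  have -> : z - a1 + (t - a1) = z + t - a1 - a1 by group_ring.
  by rewrite E; group_ring.
move: u; rewrite /= !inE !negb_or => /and5P[/and5P[n1' n2 n3 n4 n5] /and4P[n6 n7 n8 n9] /and3P[n10 n11 n12] /andP[n13 n14] /andP[n15 _]].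
have e1 : cls (a2 - a1) + cls (b2 - a1) = cls (b1 - a1).
  by apply: D; rewrite -s12 addrC.
have e2 : cls (a2 - a1) + cls (b1 - a1) = cls (b2 - a1).
  by rewrite -e1 addrA addTT add0r.
have N' z t : cls t != cls z -> cls (z - a1) != cls (t - a1) by rewrite eq_sym; apply: N.
have N0' z : cls a1 != cls z -> cls (z - a1) != 0 by rewrite eq_sym; apply: N0.
split; split; rewrite ?inE ?negb_or ?e1 ?e2.
- exact: N0'.
- by rewrite (N0' _ n2) (N' _ _ n6).
- by rewrite (N0' _ n4) (N' _ _ n8) (N' _ _ n11) (N' _ _ n13).
- exact: N0'.
- by rewrite (N0' _ n2) (N _ _ n10).
by rewrite (N0' _ n4) (N' _ _ n13) (N' _ _ n11) (N' _ _ n8).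
Qed.

Lemma translate_perm (f : G) (s t : seq G) : perm_eq s t ->
  perm_eq (translate (- f) s) [seq - f + z | z <- t].
Proof. exact: perm_map. Qed.

Lemma twice_translate (z f : G) : z + z = f + f -> (z - f) + (z - f) = 0.
Proof. by move=> E; rewrite addrACA E addrACA addrN addr0. Qed.

Lemma three_good x y a1 k1 b1 l1 a2 k2 b2 l2 a3 k3 b3 l3 :
  odd_blocks x y a1 k1 b1 l1 a2 k2 b2 l2 a3 k3 b3 l3 ->
  good x y a1 b1 -> good x y a2 b2 -> good x y a3 b3 -> structured.
Proof.
case=> pe u [s12 s23] sxy [g cx cy xy] [ax1 by1] [ax2 by2] [ax3 by3].
have /eqP nxy := generates_neq n1 g.
have [ind _] := independent_of_six u s12 s23.
have d1 : (a2 - a1) + (a2 - a1) = 0 by apply: twice_translate; rewrite ax1 ax2.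
have d2 : (a3 - a1) + (a3 - a1) = 0 by apply: twice_translate; rewrite ax1 ax3.
have g3 : generates e n ((b1 - a1) + (b1 - a1)).
  have -> : (b1 - a1) + (b1 - a1) = - (x - y) by rewrite -ax1 -by1; group_ring.
  exact: generatesN.
have [|bas o1 o2 o3] := basis_of_classes d2 d1 g3; first exact: ind.
have eqs : (k1 + k2 + k3 = n - 1)%N /\ (l1 + l2 + l3 = n - 1)%N.
  move: cx cy; rewrite !count_cat !count_nseq /= ax1 ax2 ax3 by1 by2 by3 !eqxx.
  rewrite eq_sym; have /negbTE-> : x != y by apply/eqP.
  by rewrite !mul1n !mul0n !add0n; clear; lia.
exists (a3 - a1), (a2 - a1), (b1 - a1), a1; split=> //; apply: Or33.
set f1 := a3 - a1 in d2 *; set f2 := a2 - a1 in d1 *; set f3 := b1 - a1.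
(* After translation by -a1, the values b1, b2, b3 become f3, f3 + f2, f3 + f1. Their multiplicities
   being odd, S' has sum f2 + f1, the one element of the subgroup that it avoids. *)
exists k1, k3, k2, (nseq (2 * l1 + 1) 0 ++ nseq (2 * l2 + 1) f2 ++ nseq (2 * l3 + 1) f1).
have odd_mul (f : G) k : f + f = 0 -> f *+ (2 * k + 1) = f.
  by move=> ff; rewrite addn1 mulrS mulrnA mulr2n ff mul0rn addr0.
have sumS : \sum_(d <- nseq (2 * l1 + 1) 0 ++ nseq (2 * l2 + 1) f2 ++ nseq (2 * l3 + 1) f1) d
    = f2 + f1.
  by rewrite !big_cat /= !big_nseq !iter_addr_0 mul0rn add0r !odd_mul.
have c0 (z : G) : cls z != 0 -> z != 0 by apply: contra => /eqP->; rewrite raddf0.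
case: ind => n3 n2; rewrite !inE !negb_or => /and4P[m1 m2 m3 _].
have [n20 n23] : cls f2 != 0 /\ cls f2 != cls f3 by move: n2; rewrite !inE negb_or => /andP[].
split.
- by case: eqs => E _; split; move: E; clear; lia.
- by rewrite !size_cat !size_nseq; case: eqs => _; move: n1; clear; lia.
- move=> d; rewrite !mem_cat !mem_nseq => /or3P[]/andP[_ /eqP->].
  + exact: group1.
  + by apply: mem_gen; rewrite !inE eqxx orbT.
  by apply: mem_gen; rewrite !inE eqxx.
- rewrite sumS !mem_cat !mem_nseq !negb_or !negb_and; apply/and3P; split; apply/orP; right.
  + apply: c0; rewrite raddfD; apply: contra m3 => /eqP E.
    by rewrite -(addr0 (cls f1)) -E addrCA addTT addr0.
  + by rewrite -subr_eq0 addrC addKr; apply: c0.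
  by rewrite -subr_eq0 addrK; apply: c0.
rewrite (permPl (translate_perm a1 pe)) !map_cat !map_nseq.
have -> : - a1 + a1 = 0 by rewrite addNr.
have -> : - a1 + a2 = f2 by rewrite addrC.
have -> : - a1 + a3 = f1 by rewrite addrC.
have -> : - a1 + b1 = f3 + 0 by rewrite addr0 addrC.
have -> : - a1 + b2 = f3 + f2.
  have -> : b2 = a1 + b1 - a2 by rewrite s12; group_ring.
  by rewrite -(subr0 (f3 + f2)) -d1; rewrite /f2 /f3; group_ring.
have -> : - a1 + b3 = f3 + f1.
  have -> : b3 = a1 + b1 - a3 by rewrite s12 s23; group_ring.
  by rewrite -(subr0 (f3 + f1)) -d2; rewrite /f1 /f3; group_ring.
by apply/seq.permP => P; count_lia.
Qed.

(* As 2 f3 generates 2G, the coefficient j is determined by the double of z,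
   and the values 0 and 1 are those for which z belongs to a good pair. *)
Lemma bad_coefficient x y a b z k l : generates e n (y - x) -> a + a = x -> b + b = y ->
  cls (z + z) = 0 -> bad x y z k l ->
  exists j, (2 <= j <= n - 1)%N /\
   (z - a - (b - a) *~ j%:Z) + (z - a - (b - a) *~ j%:Z) = 0.
Proof.
move=> g ax by_ cz [nzx nzy _ _].
have [|j ltj Ej] := g.1 (z + z - (a + a)).
  by apply: cls_ker; rewrite raddfB cz raddfD addTT subrr.
exists j; split; last first.
  have -> : (z - a - (b - a) *~ j%:Z) + (z - a - (b - a) *~ j%:Z)
    = z + z - (a + a) - (b + b - (a + a)) *+ j by group_ring.
  by rewrite Ej ax by_ subrr.
case: j ltj Ej => [|[|j]] ltj Ej.
- by case: nzx; apply/eqP; rewrite -subr_eq0 -ax Ej mulr0n.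
- by case: nzy; apply: (addIr (- x)); rewrite -{1}ax Ej mulr1n.
by move: ltj; clear; lia.
Qed.

Lemma mulrz_class (f : G) j : cls (f *~ j) \in [:: 0; cls f].
Proof. by rewrite raddfMz mulrz_T !inE; case: (odd _); rewrite eqxx ?orbT. Qed.

Lemma two_good x y a1 k1 b1 l1 a2 k2 b2 l2 a3 k3 b3 l3 :
  odd_blocks x y a1 k1 b1 l1 a2 k2 b2 l2 a3 k3 b3 l3 ->
  good x y a1 b1 -> good x y a2 b2 -> bad x y a3 k3 l3 -> structured.
Proof.
case=> pe u [s12 s23] sxy [g cx cy xy] [ax1 by1] [ax2 by2] B3.
have /eqP nxy := generates_neq n1 g.
have g' : generates e n (y - x) by rewrite -opprB; apply: generatesN.
have [_ ind] := independent_of_six u s12 s23.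
have d2 : (a2 - a1) + (a2 - a1) = 0 by apply: twice_translate; rewrite ax1 ax2.
have g3 : generates e n ((b2 - a1) + (b2 - a1)).
  by have -> : (b2 - a1) + (b2 - a1) = y - x by rewrite -ax1 -by2; group_ring.
have [|j [jn d1]] := bad_coefficient g' ax1 by2 _ B3; first by rewrite raddfD addTT.
have [_ _ k30 l30] := B3.
have mj : - cls ((b2 - a1) *~ j%:Z) \in [:: 0; cls (b2 - a1)].
  by rewrite -raddfN -mulrNz mulrz_class.
have ind' := independent_classes_shift (mem_head 0 [:: cls (b2 - a1)]) mj ind.
rewrite addr0 -raddfB in ind'.
have [bas o1 o2 o3] := basis_of_classes d1 d2 g3 ind'.
set f3 := b2 - a1 in d1 bas o1 o3; set f2 := a2 - a1 in d2 bas o2.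
set f1 := a3 - a1 - f3 *~ j%:Z in d1 bas o1.
have eqs : (k1 + k2 = n - 1)%N /\ (l1 + l2 = n - 1)%N.
  move: cx cy; rewrite k30 l30 !count_cat !count_nseq /= ax1 ax2 by1 by2 !eqxx.
  rewrite eq_sym; have /negbTE-> : x != y by apply/eqP.
  by rewrite !mul1n !mul0n !muln0 !add0n !addn0; clear; lia.
exists f1, f2, f3, a1; split=> //; apply: Or31.
exists j, k1, l1; split=> //; [by case: eqs => + _; clear; lia | by case: eqs => _; clear; lia | ].
rewrite (permPl (translate_perm a1 pe)) !map_cat !map_nseq k30 l30 /=.
have -> : (2 * n - 2 * k1 - 1 = 2 * k2 + 1)%N by case: eqs => + _; move: n1; clear; lia.
have -> : (2 * n - 1 - 2 * l1 = 2 * l2 + 1)%N by case: eqs => _; move: n1; clear; lia.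
have -> : - a1 + a1 = 0 by rewrite addNr.
have -> : - a1 + a2 = f2 by rewrite addrC.
have -> : - a1 + b2 = f3 by rewrite addrC.
have -> : - a1 + b1 = f3 + f2.
  have -> : b1 = a2 + b2 - a1 by rewrite -s12; group_ring.
  by rewrite /f2 /f3; group_ring.
have -> : - a1 + a3 = f3 *~ j%:Z + f1 by rewrite /f1; group_ring.
have -> : - a1 + b3 = f3 *~ (1 - j%:Z) + f2 + f1.
  have -> : b3 = a2 + b2 - a3 by rewrite s23; group_ring.
  (* The computation yields -f1 in place of f1; subtracting 2 f1 = 0 reconciles the two. *)
  rewrite -(subr0 (_ + f1)) -d1 /f1 /f2 /f3; group_ring.
by apply/seq.permP => P; count_lia.
Qed.

Lemma one_good x y a1 k1 b1 l1 a2 k2 b2 l2 a3 k3 b3 l3 :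
  odd_blocks x y a1 k1 b1 l1 a2 k2 b2 l2 a3 k3 b3 l3 ->
  good x y a1 b1 -> bad x y a2 k2 l2 -> bad x y a3 k3 l3 -> structured.
Proof.
move=> ob G1 B2 B3; have [_ _ _ _ [g _ _ _]] := ob; have [ax1 by1] := G1.
have g' : generates e n (y - x) by rewrite -opprB; apply: generatesN.
have [|i [iN di]] := bad_coefficient g' ax1 by1 _ B2; first by rewrite raddfD addTT.
have [|j [jn dj]] := bad_coefficient g' ax1 by1 _ B3; first by rewrite raddfD addTT.
(* The order b <= a of the parameters in (s2) is arranged by interchanging the second and third
   couples. *)
wlog le_ji : a2 k2 b2 l2 a3 k3 b3 l3 i j ob B2 B3 iN di jn dj / (j <= i)%N.
  move=> W; have [le|lt] := leqP j i; first by apply: (W _ _ _ _ _ _ _ _ i j ob).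
  by apply: (W _ _ _ _ _ _ _ _ j i (odd_blocks_swap ob)) => //; apply: ltnW.
case: ob => pe u [s12 s23] sxy [_ cx cy xy].
have /eqP nxy := generates_neq n1 g.
have [ind _] := independent_of_six u s12 s23.
have g3 : generates e n ((b1 - a1) + (b1 - a1)).
  by have -> : (b1 - a1) + (b1 - a1) = y - x by rewrite -ax1 -by1; group_ring.
have [_ _ k30 l30] := B3; have [_ _ k20 l20] := B2.
have mj (h : nat) : - cls ((b1 - a1) *~ h%:Z) \in [:: 0; cls (b1 - a1)].
  by rewrite -raddfN -mulrNz mulrz_class.
have ind' := independent_classes_shift (mj i) (mj j) ind.
rewrite -!raddfB in ind'.
have [bas o1 o2 o3] := basis_of_classes dj di g3 ind'.
set f3 := b1 - a1 in di dj bas o1 o2 o3.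
set f2 := a2 - a1 - f3 *~ i%:Z in di bas o2.
set f1 := a3 - a1 - f3 *~ j%:Z in dj bas o1.
have eqs : (k1 = n - 1)%N /\ (l1 = n - 1)%N.
  move: cx cy; rewrite k30 l30 k20 l20 !count_cat !count_nseq /= ax1 by1 !eqxx.
  rewrite eq_sym; have /negbTE-> : x != y by apply/eqP.
  by rewrite !mul1n !mul0n !muln0 !add0n !addn0; clear; lia.
exists f1, f2, f3, a1; split=> //; apply: Or32.
exists i, j; split=> //.
rewrite (permPl (translate_perm a1 pe)) !map_cat !map_nseq k30 l30 k20 l20 /=.
have [-> ->] := eqs.
have -> : (2 * (n - 1) + 1 = 2 * n - 1)%N by move: n1; clear; lia.
have -> : - a1 + a1 = 0 by rewrite addNr.
have -> : - a1 + b1 = f3 by rewrite addrC.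
have -> : - a1 + a2 = f3 *~ i%:Z + f2 by rewrite /f2; group_ring.
have -> : - a1 + a3 = f3 *~ j%:Z + f1 by rewrite /f1; group_ring.
have -> : - a1 + b2 = f3 *~ (1 - i%:Z) + f2.
  have -> : b2 = a1 + b1 - a2 by rewrite s12; group_ring.
  rewrite -(subr0 (_ + f2)) -di /f2 /f3; group_ring.
have -> : - a1 + b3 = f3 *~ (1 - j%:Z) + f1.
  have -> : b3 = a1 + b1 - a3 by rewrite s12 s23; group_ring.
  rewrite -(subr0 (_ + f1)) -dj /f1 /f3; group_ring.
by apply/seq.permP => P; count_lia.
Qed.

Lemma structured_of_odd_blocks x y a1 k1 b1 l1 a2 k2 b2 l2 a3 k3 b3 l3 :
  odd_blocks x y a1 k1 b1 l1 a2 k2 b2 l2 a3 k3 b3 l3 -> structured.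
Proof.
move=> ob.
wlog h1 : a1 k1 b1 l1 ob / good x y a1 b1 \/ bad x y a1 k1 l1.
  move=> W; case: (good_or_bad ob) => h; [|apply: W (odd_blocks_flip ob) _; by left|].
    by apply: W ob _; left.
  by apply: W ob _; right.
have ob2 := odd_blocks_rot ob.
wlog h2 : a2 k2 b2 l2 {ob} ob2 / good x y a2 b2 \/ bad x y a2 k2 l2.
  move=> W; case: (good_or_bad ob2) => h; [|apply: W (odd_blocks_flip ob2) _; by left|].
    by apply: W ob2 _; left.
  by apply: W ob2 _; right.
have ob3 := odd_blocks_rot ob2.
wlog h3 : a3 k3 b3 l3 {ob2} ob3 / good x y a3 b3 \/ bad x y a3 k3 l3.
  move=> W; case: (good_or_bad ob3) => h; [|apply: W (odd_blocks_flip ob3) _; by left|].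
    by apply: W ob3 _; left.
  by apply: W ob3 _; right.
have {}ob := odd_blocks_rot ob3; have ob2 := odd_blocks_rot ob.
case: h1 => h1; case: h2 => h2; case: h3 => h3.
- exact: three_good ob h1 h2 h3.
- exact: two_good ob h1 h2 h3.
- exact: two_good ob3 h3 h1 h2.
- exact: one_good ob h1 h2 h3.
- exact: two_good ob2 h2 h3 h1.
- exact: one_good ob2 h2 h3 h1.
- exact: one_good ob3 h3 h1 h2.
(* Three bad couples leave no pair at all, but x must occur n - 1 > 0 times among the pair sums. *)
case: ob => _ _ _ _ [_ cx _ _]; case: h1 => _ _ p1 q1; case: h2 => _ _ p2 q2.
case: h3 => _ _ p3 q3; move: cx; rewrite p1 q1 p2 q2 p3 q3 /=.
by move: n1; clear; lia.
Qed.
End Families.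

(** * The converse *)

Lemma natr_Z2_eq0 m : (m%:R == 0 :> 'Z_2) = ~~ odd m.
Proof. by rewrite -val_eqE /= val_Zp_nat // modn2 eqb0. Qed.

Section Residue.
Variables (n : nat) (n1 : (1 < n)%N).

Definition parity (k : 'Z_(2 * n)) : 'Z_2 := (val k)%:R.

Lemma parity_is_additive : zmod_morphism parity.
Proof.
have n2 : (1 < 2 * n)%N by move: n1; clear; lia.
have two0 : 2%:R = 0 :> 'Z_2 by apply/eqP; rewrite natr_Z2_eq0.
have modE m : (m %% (2 * n))%:R = m%:R :> 'Z_2.
  by rewrite {2}(divn_eq m (2 * n)) natrD mulnCA natrM two0 mul0r add0r.
have D : {morph parity : x y / x + y}.
  by move=> x y; rewrite /parity /= [X in (_ %% X)%N]Zp_cast // modE natrD.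
move=> x y; apply: (addIr (parity y)); by rewrite -D !subrK.
Qed.
End Residue.

(** The element [e0] generates the factor C_2n. Having a non-zero class and a double that generates
    2G, it has order 2n, which later computes the exponent. *)
Lemma class_map (G : finZmodType) n : (1 < n)%N -> is_C2_C2_C2n G n ->
  exists (e e0 : G) (cls : {additive G -> classes3}),
  [/\ forall z : int, (e *~ z == 0) = (n %| z)%Z,
      forall g, cls g = 0 -> multiple e g, e0 + e0 = e & cls e0 != 0].
Proof.
move=> n1 [phi [psi psiK phiK]]; have n2 : (1 < 2 * n)%N by move: n1; clear; lia.
have phi_inj := can_inj psiK.
pose c (g : G) : classes3 := ((phi g).1, parity (phi g).2).
have cZ : zmod_morphism c.
  by move=> x y; rewrite /c raddfB /= (parity_is_additive n1).
pose cls : {additive G -> classes3} := HB.pack c (GRing.isZmodMorphism.Build _ _ c cZ).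
have Z0 m : (m%:R == 0 :> 'Z_(2 * n)) = (2 * n %| m)%N.
  by rewrite -val_eqE /= val_Zp_nat.
pose e0 := psi (0, 0, 1).
have pe0 : phi e0 = (0, 0, 1) by rewrite phiK.
have pem m : phi ((e0 + e0) *+ m) = (0, 0, (2 * m)%:R).
  rewrite -mulr2n -mulrnA raddfMn pe0.
  elim: (2 * m)%N => // k IH; rewrite mulrS IH (mulrS 1).
  by congr (_, _, _); apply: addr0.
have e0m m : ((e0 + e0) *+ m == 0) = (n %| m)%N.
  rewrite -(inj_eq phi_inj) pem raddf0 -[RHS](@dvdn_pmul2l 2) // -Z0.
  by apply/eqP/eqP => [[]|->].
exists (e0 + e0), e0, cls; split=> //.
- case=> m; first by rewrite -pmulrn e0m.
  by rewrite NegzE mulrNz -pmulrn oppr_eq0 e0m dvdzE abszN.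
- move=> g; rewrite /= /c; case Eg: (phi g) => [p k] /= [Ep /eqP].
  rewrite natr_Z2_eq0 => ok; exists (val k)./2; rewrite -pmulrn; apply: phi_inj.
  have Ek : (2 * (val k)./2 = val k)%N.
    by rewrite mul2n -[RHS]odd_double_half (negbTE ok).
  by rewrite pem Eg Ep Ek natr_Zp.
by apply/eqP; rewrite /= /c pe0 => /(congr1 snd)/eqP; rewrite /= /parity natr_Z2_eq0.
Qed.

Section Converse.
Variables (G : finZmodType) (n : nat).
Hypotheses (n1 : (1 < n)%N).
Variables (A : comNzRingType) (phi : {additive G -> A}).
Hypothesis phi_inj : injective phi.

Ltac group_ring :=
  apply: phi_inj; rewrite ?(raddfMn phi, raddfMz phi, raddf0 phi, raddfD phi, raddfN phi); ring.

(** Repeated use describes a subsequence of an explicit sequence by one multiplicity per factor. As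
    [a] may recur in [L], [t] takes as many copies as [k] allows. *)
Lemma subsequence_nseq (a : G) k (U L : seq G) : is_subsequence U (nseq k a ++ L) ->
  exists t V, [/\ (t <= k)%N, perm_eq U (nseq t a ++ V) & is_subsequence V L].
Proof.
move=> sub; have [|t [V [pe /all_pred1P Et st]]] :=
  @count_extract _ (pred1 a) (minn k (count_mem a U)) U; first exact: geq_minr.
exists (minn k (count_mem a U)), V; rewrite geq_minl -st -Et; split=> // x.
have := sub x; rewrite (seq.permP pe) !count_cat Et !count_nseq /=.
have [<-|nx] := eqVneq a x; last by rewrite !mul0n.
have := seq.permP pe (pred1 a); rewrite count_cat {1}Et count_nseq /= eqxx !mul1n st.
by move: (count _ _) (count _ _) (count _ _) => i j l; clear; lia.
Qed.

Lemma subsequence1 (a : G) (U L : seq G) : is_subsequence U (a :: L) ->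
  exists t V, [/\ (t <= 1)%N, perm_eq U (nseq t a ++ V) & is_subsequence V L].
Proof. exact: (@subsequence_nseq a 1). Qed.

Lemma subsequence_nil (U : seq G) : is_subsequence U [::] -> U = [::].
Proof. by case: U => // a U /(_ a); rewrite /= eqxx. Qed.

Lemma subsequence_perm (U L L' : seq G) : perm_eq L L' -> is_subsequence U L ->
  is_subsequence U L'.
Proof. by move=> pe sub x; rewrite -(seq.permP pe). Qed.

Lemma subsequence_map (U L : seq G) (f : G) : is_subsequence U L ->
  is_subsequence [seq f + x | x <- U] [seq f + x | x <- L].
Proof.
move=> sub x; rewrite !count_map.
have E : preim (fun y => f + y) (pred1 x) =1 pred1 (x - f).
  by move=> y /=; apply/eqP/eqP => [<-|->]; [rewrite (addrC f) addrK | rewrite addrC subrK].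
by rewrite !(eq_count E).
Qed.

Lemma subsequence_complement (U L : seq G) : is_subsequence U L -> exists V, perm_eq L (U ++ V).
Proof.
elim: U L => [|a U IH] L sub; first by exists L.
have aL : a \in L by rewrite -has_pred1 has_count (leq_trans _ (sub a)) //= eqxx.
have pe := perm_to_rem aL.
have [|V pV] := IH (rem a L).
  by move=> x; have := sub x; rewrite (seq.permP pe) /= leq_add2l.
by exists V; rewrite (permPl pe) /= perm_cons.
Qed.

Variables f1 f2 f3 : G.
Hypotheses (bas : is_basis [tuple f1; f2; f3]).
Hypotheses (o1 : #[f1]%g = 2%N) (o2 : #[f2]%g = 2%N) (o3 : #[f3]%g = (2 * n)%N).

Lemma order_dvdz (f : G) (z : int) : f *~ z = 0 -> (#[f]%g %| z)%Z.
Proof.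
have key m : f *+ m = 0 -> (#[f]%g %| m)%N.
  by move=> E; rewrite order_dvdn FinRing.zmodXgE E.
case: z => m; first by rewrite -pmulrn => /key.
by rewrite NegzE mulrNz -pmulrn dvdzE abszN => /eqP; rewrite oppr_eq0 => /eqP/key.
Qed.

Lemma basis_coefficients (p q : nat) (r : int) : f1 *+ p + f2 *+ q + f3 *~ r = 0 ->
  [/\ (2 %| p)%N, (2 %| q)%N & ((2 * n)%N %| r)%Z].
Proof.
move=> E; have [ind _] := bas.
pose a (i : 'I_3) : int := nth 0 [:: p%:Z; q%:Z; r] i.
have := ind a; rewrite !big_ord_recl big_ord0 !(tnth_nth 0) /= addr0 addrA -!pmulrn E.
move=> /(_ erefl) h; split.
- by have := h ord0; rewrite (tnth_nth 0) /= => /order_dvdz; rewrite o1.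
- by have := h (lift ord0 ord0); rewrite (tnth_nth 0) /= => /order_dvdz; rewrite o2.
by have := h (lift ord0 (lift ord0 ord0)); rewrite (tnth_nth 0) /= => /order_dvdz; rewrite o3.
Qed.

Lemma dvdn_small m k : (m %| k)%N -> (k < 2 * m)%N -> k = 0%N \/ k = m.
Proof.
case/dvdnP => [[|[|i]] ->]; [by left | by right; rewrite mul1n | ].
by rewrite ltn_mul2r => /andP[].
Qed.

(** Evenness at f1 gives t4 = t5, so the coefficient of f3 is t2 + t3 + t4, independent of a and
    equal to 0 or 2n. Then either t0 + t1 = 2n with t1 even, or t2 + t3 = 2n with t3 even. In both
    cases the two bounds are odd with sum 2n, so the even number stays below its bound and the total
    below 2n. *)
Lemma family_s1_no_zero_sum (S U : seq G) : family_s1 n f1 f2 f3 S ->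
  is_subsequence U S -> size U = (2 * n)%N -> \sum_(x <- U) x <> 0.
Proof.
case=> a [al [be [an aln ben pe]]] /(subsequence_perm pe).
case/subsequence_nseq => t0 [U0 [l0 p0]]; case/subsequence_nseq => t1 [U1 [l1 p1]].
case/subsequence_nseq => t2 [U2 [l2 p2]]; case/subsequence_nseq => t3 [U3 [l3 p3]].
case/subsequence1 => t4 [U4 [l4 p4]]; case/subsequence1 => t5 [U5 [l5 p5]].
move/subsequence_nil => E5; rewrite {}E5 cats0 in p5.
rewrite (perm_size p0) size_cat (perm_size p1) size_cat (perm_size p2) size_cat.
rewrite (perm_size p3) size_cat (perm_size p4) size_cat (perm_size p5) !size_nseq => sz.
rewrite (perm_big _ p0) big_cat (perm_big _ p1) big_cat (perm_big _ p2) big_cat.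
rewrite (perm_big _ p3) big_cat (perm_big _ p4) big_cat (perm_big _ p5) !big_nseq !iter_addr_0.
move=> /= E0.
have {}E0 : f1 *+ (t4 + t5) + f2 *+ (t1 + t3 + t5) + f3 *~ ((t2 + t3)%N%:Z + a%:Z * t4%:Z + (1 - a%:Z) * t5%:Z) = 0.
  by rewrite -[RHS]E0; group_ring.
have [d1 d2] := basis_coefficients E0.
have Et : t4 = t5 by move: l4 l5 d1; case: (t4) => [|[|]] //; case: (t5) => [|[|]].
rewrite -Et (_ : _ + _ * t4%:Z = (t2 + t3 + t4)%N%:Z); last by rewrite !PoszD; ring.
rewrite dvdzE /= => d3; have lt3 : (t2 + t3 + t4 < 2 * (2 * n))%N.
  by move: l2 l3 l4 ben n1; clear; lia.
move: d2 (dvdn_small d3 lt3) l0 l1 l2 l3 l4 aln ben sz n1; rewrite -Et dvdn2; clear.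
move=> d2; case=> E; lia.
Qed.

Lemma family_s2_no_zero_sum (S U : seq G) : family_s2 n f1 f2 f3 S ->
  is_subsequence U S -> size U = (2 * n)%N -> \sum_(x <- U) x <> 0.
Proof.
case=> a [b [an bn ba pe]] /(subsequence_perm pe).
case/subsequence_nseq => t0 [U0 [l0 p0]]; case/subsequence_nseq => t1 [U1 [l1 p1]].
case/subsequence1 => t2 [U2 [l2 p2]]; case/subsequence1 => t3 [U3 [l3 p3]].
case/subsequence1 => t4 [U4 [l4 p4]]; case/subsequence1 => t5 [U5 [l5 p5]].
move/subsequence_nil => E5; rewrite {}E5 cats0 in p5.
rewrite (perm_size p0) size_cat (perm_size p1) size_cat (perm_size p2) size_cat.
rewrite (perm_size p3) size_cat (perm_size p4) size_cat (perm_size p5) !size_nseq => sz.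
rewrite (perm_big _ p0) big_cat (perm_big _ p1) big_cat (perm_big _ p2) big_cat.
rewrite (perm_big _ p3) big_cat (perm_big _ p4) big_cat (perm_big _ p5) !big_nseq !iter_addr_0.
move=> /= E0.
have {}E0 : f1 *+ (t4 + t5) + f2 *+ (t2 + t3) + f3 *~ (t1%:Z + a%:Z * t2%:Z + (1 - a%:Z) * t3%:Z
    + b%:Z * t4%:Z + (1 - b%:Z) * t5%:Z) = 0.
  by rewrite -[RHS]E0; group_ring.
have [d1 d2] := basis_coefficients E0.
have Et : t4 = t5 by move: l4 l5 d1; case: (t4) => [|[|]] //; case: (t5) => [|[|]].
have Eu : t2 = t3 by move: l2 l3 d2; case: (t2) => [|[|]] //; case: (t3) => [|[|]].
rewrite -Et -Eu (_ : _ + _ * t4%:Z = (t1 + t2 + t4)%N%:Z); last by rewrite !PoszD; ring.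
rewrite dvdzE /= => d3; have lt3 : (t1 + t2 + t4 < 2 * (2 * n))%N.
  by move: l1 l2 l4 n1; clear; lia.
move: (dvdn_small d3 lt3) l0 l1 sz n1; rewrite -Et -Eu; clear.
by case=> E; lia.
Qed.

Lemma mem_gen_pair d : d \in <<[set f1; f2]>>%g -> exists i j, d = f1 *+ i + f2 *+ j.
Proof.
case/gen_prodgP => m [c cin ->]; elim: m c cin => [|m IH] c cin.
  by exists 0%N, 0%N; rewrite big_ord0 addr0.
rewrite big_ord_recl; have [|i [j ->]] := IH (fun i => c (lift ord0 i)) _ => //.
rewrite FinRing.zmodMgE; have := cin ord0; rewrite !inE => /orP[]/eqP->.
  by exists i.+1, j; rewrite mulrS addrA.
by exists i, j.+1; rewrite mulrS addrCA.
Qed.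

Lemma sum_gen_pair (D : seq G) : {subset D <= <<[set f1; f2]>>%g} ->
  exists i j, \sum_(d <- D) d = f1 *+ i + f2 *+ j.
Proof.
elim: D => [|d D IH] sub; first by exists 0%N, 0%N; rewrite big_nil addr0.
have [i [j Ed]] := mem_gen_pair (sub d (mem_head d D)).
have [|i' [j' ED]] := IH; first by move=> x xD; apply: sub; rewrite inE xD orbT.
by exists (i + i')%N, (j + j')%N; rewrite big_cons Ed ED !mulrnDr addrACA.
Qed.

(** The number of terms f3 + d_i used is 0 or 2n. If it is 0, then t0, t1, t2 are even and stay
    below their odd bounds, adding up to at most 2n - 2. If it is 2n, a single d_i is omitted and,
    the others having sum 0, it equals the sum of S'. *)
Lemma family_s3_no_zero_sum (S U : seq G) : family_s3 n f1 f2 f3 S ->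
  is_subsequence U S -> size U = (2 * n)%N -> \sum_(x <- U) x <> 0.
Proof.
case=> al [be [ga [S' [[aln ben gan abg] sS' subS' sumS' pe]]]] /(subsequence_perm pe).
case/subsequence_nseq => t0 [U0 [l0 p0]]; case/subsequence_nseq => t1 [U1 [l1 p1]].
case/subsequence_nseq => t2 [U2 [l2 p2]] subU2.
pose D := [seq - f3 + x | x <- U2].
have subD : is_subsequence D S'.
  by have := subsequence_map (- f3) subU2; rewrite (mapK (addKr f3)).
have EU2 : U2 = [seq f3 + d | d <- D] by rewrite /D (mapK (addNKr f3)).
have [V pV] := subsequence_complement subD.
have DS : {subset D <= <<[set f1; f2]>>%g}.
  by move=> d dD; apply: subS'; rewrite (perm_mem pV) mem_cat dD.
have [i [j ED]] := sum_gen_pair DS.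
have sumU2 : \sum_(x <- U2) x = f3 *+ size D + \sum_(d <- D) d.
  rewrite EU2 big_map; elim: (D) => [|d D' IH]; first by rewrite !big_nil addr0.
  by rewrite !big_cons IH /= mulrS addrACA.
have sU2 : size U2 = size D by rewrite size_map.
rewrite (perm_size p0) size_cat (perm_size p1) size_cat (perm_size p2) size_cat sU2 !size_nseq => sz.
rewrite (perm_big _ p0) big_cat (perm_big _ p1) big_cat (perm_big _ p2) big_cat /= sumU2.
rewrite !big_nseq !iter_addr_0 => E0.
have [d1 d2 d3] : [/\ (2 %| t1 + i)%N, (2 %| t2 + j)%N & ((2 * n)%N %| (size D)%:Z)%Z].
  by apply: basis_coefficients; rewrite -[RHS]E0 ED; group_ring.
have sV : (size D + size V = 2 * n + 1)%N by rewrite -sS' (perm_size pV) size_cat.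
have {}d3 : (2 * n %| size D)%N := d3.
have [|D0|Dn] := dvdn_small d3; first by move: sV n1; move: (size D) (size V); clear; lia.
  have [e1 e2 _] : [/\ (2 %| t1)%N, (2 %| t2)%N & ((2 * n)%N %| 0)%Z].
    apply: basis_coefficients; rewrite -[RHS]E0 (size0nil D0) big_nil /=; group_ring.
  rewrite !dvdn2 in e1 e2; move: sz; rewrite D0.
  by move: e1 e2 l0 l1 l2 abg n1; clear; lia.
have [Et0 Et1 Et2] : [/\ t0 = 0, t1 = 0 & t2 = 0]%N by split; move: sz; rewrite Dn; clear; lia.
case: V pV sV => [|v [|v' V]] pV sV; try by move: sV; rewrite Dn /=; clear; lia.
have D0 : \sum_(d <- D) d = 0.
  rewrite Et0 Et1 Et2 Dn -o3 -FinRing.zmodXgE expg_order !mulr0n !add0r in E0.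
  exact: E0.
move: sumS'; rewrite (perm_big _ pV) big_cat /= D0 big_cons big_nil add0r addr0.
by rewrite (perm_mem pV) mem_cat inE eqxx orbT.
Qed.
End Converse.

Theorem theorem5p1 (G : finZmodType) (n : nat) (hn : (2 <= n)%N)
    (hG : is_C2_C2_C2n G n) (S : seq G) (hS : size S = (4 * n + 2)%N) :
  ~ (exists T : seq G,
       [/\ is_subsequence T S, size T = exponent [set: G] & zero_sum T])
  <->
  exists f1 f2 f3 f : G,
    [/\ is_basis [tuple f1; f2; f3],
        #[f1]%g = 2%N, #[f2]%g = 2%N, #[f3]%g = (2 * n)%N &
        [\/ family_s1 n f1 f2 f3 (translate (- f) S),
            family_s2 n f1 f2 f3 (translate (- f) S) |
            family_s3 n f1 f2 f3 (translate (- f) S)]].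
Proof.
have [phi bij_phi] := hG; have phi_inj := bij_inj bij_phi.
have [e [e0 [cls [e_order cls_ker e00 ce0]]]] := class_map hn hG.
have ge : generates e n (e0 + e0).
  rewrite e00; split=> [q [z ->]|j E].
    have [j ltj D] := @solve_linear_mod n z 1 (ltnW hn) (coprime1n _).
    exists j => //; rewrite pmulrn; apply/eqP; rewrite -subr_eq0 -mulrzBr e_order.
    by rewrite mulr1 in D.
  by have := e_order j; rewrite -pmulrn E eqxx => /esym.
have twon (f : G) : f *+ (2 * n) = 0.
  rewrite mulrnA mulr2n; apply: (multiple_mulrn e_order).
  by apply: cls_ker; rewrite raddfD addTT.
have expG : exponent [set: G] = (2 * n)%N.
  apply/eqP; rewrite eqn_dvd; apply/andP; split.
    by apply/exponentP => f _; rewrite FinRing.zmodXgE twon.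
  by rewrite -(double_order e_order cls_ker ce0 ge) dvdn_exponent ?inE.
rewrite expG; split=> [none|[f1 [f2 [f3 [f [bas o1 o2 o3 fam]]]]] [U [sub sU zU]]].
  have nb : ~ has_block (pred1 0) (2 * n) S.
    case=> t [r [pe st /eqP Zt]]; apply: none; exists t; split=> // x.
    by rewrite (seq.permP pe) count_cat leq_addr.
  have [x [y [a1 [k1 [b1 [l1 [a2 [k2 [b2 [l2 [a3 [k3 [b3 [l3 ob]]]]]]]]]]]]]] :=
    odd_blocks_exist hn e_order cls_ker phi_inj nb hS.
  exact: (structured_of_odd_blocks hn e_order cls_ker phi_inj ob).
(* Translation changes the sum of 2n terms by a multiple of 2n, hence not at all. *)
have subT := subsequence_map (- f) sub.
have sT : size [seq - f + x | x <- U] = (2 * n)%N by rewrite size_map.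
have zT : \sum_(x <- [seq - f + x | x <- U]) x = 0.
  rewrite big_map big_split /= zU addr0 big_const_seq count_predT iter_addr_0 sU.
  exact: twon.
case: fam => fam.
- exact: (family_s1_no_zero_sum hn phi_inj bas o1 o2 o3 fam subT sT zT).
- exact: (family_s2_no_zero_sum hn phi_inj bas o1 o2 o3 fam subT sT zT).
exact: (family_s3_no_zero_sum hn phi_inj bas o1 o2 o3 fam subT sT zT).
Qed.
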